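(* Let $2\le p<\infty$. Let $\alpha$ be a bounded real-valued measurable function on $\mathbb{T}$ and $\beta$ a bounded complex-valued measurable function on $\mathbb{T}$ such that the functions $\alpha,\beta,\bar\beta,\mathbf 1$ are linearly independent and $\alpha(1-\alpha)-|\beta|^2$ is positive and bounded away from zero. Put $$B=\begin{pmatrix}\alpha&\beta\\ \bar\beta&1-\alpha\end{pmatrix}.$$ Let $\Psi$ be a $2\times2$ matrix function with $\Psi,\Psi^{-1}\in H^\infty(\mathbb{M}_{2,2})$ and $B=\Psi^*\Psi$ a.e. on $\mathbb{T}$; put $A=\Psi\Psi^*$; let $Q$ be a $2\times2$ matrix function with $Q,Q^{-1}\in H^\infty(\mathbb{M}_{2,2})$ and $A^2=QQ^*$ a.e. on $\mathbb{T}$; and put $$U=\bar z\,Q^{-1}A.$$ Then $U$ is a weird $p$-badly approximable matrix function.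
   Context: $\mathbb{T}$ is the unit circle with normalized Lebesgue measure; $z$ is the identity function on $\mathbb T$. $\mathbb{M}_{2,2}$ is the space of $2\times2$ complex matrices with the operator norm on $\mathbb{C}^2$. $L^p(\mathbb{M}_{2,2})$ has norm $\|\Phi\|_{L^p}=\big(\int_{\mathbb T}\|\Phi(\zeta)\|_{\mathbb{M}_{2,2}}^p\,d\boldsymbol m(\zeta)\big)^{1/p}$, and $H^p(\mathbb{M}_{2,2})$ is its subspace of functions with entries in $H^p$. Let $q\in(2,\infty]$ satisfy $1/p+1/q=1/2$. For $\Phi\in L^p(\mathbb{M}_{2,2})$ the Hankel operator $H_\Phi:H^q(\mathbb{C}^2)\to H^2_-(\mathbb{C}^2)=L^2(\mathbb{C}^2)\ominus H^2(\mathbb{C}^2)$ is $H_\Phi f=\mathbb{P}_-\Phi f$, where $\mathbb{P}_-$ is the orthogonal projection of $L^2(\mathbb C^2)$ onto $H^2_-(\mathbb{C}^2)$ (the norm in $H^q(\mathbb C^2)$ is the $L^q$ norm of the pointwise Euclidean norm). A function $\Phi\in L^p(\mathbb{M}_{2,2})\setminus H^p(\mathbb{M}_{2,2})$ is respectable if $\|H_\Phi\|=\operatorname{dist}_{L^p}(\Phi,H^p(\mathbb{M}_{2,2}))$, and weird if it is not respectable. $\Phi$ is $p$-badly approximable if $\|\Phi\|_{L^p}=\operatorname{dist}_{L^p}(\Phi,H^p(\mathbb{M}_{2,2}))$. *)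

(* Defs.v *)
From HB Require Import structures.
From mathcomp Require Import all_boot all_order all_algebra.
From mathcomp Require Import all_classical all_reals all_analysis.
From mathcomp Require Import measurable_realfun lebesgue_measure complex.

Set Implicit Arguments.
Unset Strict Implicit.
Unset Printing Implicit Defensive.

Import Order.TTheory GRing.Theory Num.Theory.
Import numFieldNormedType.Exports ComplexField.Normc.

Local Open Scope classical_set_scope.
Local Open Scope ring_scope.
Local Open Scope complex_scope.
Local Open Scope sesquilinear_scope.

Section Circle.
Variable R : realType.

Record circle := Circle { circle_val :> R[i] ; _ : `|circle_val| == 1 }.

HB.instance Definition _ := [isSub for circle_val].
HB.instance Definition _ := [Choice of circle by <:].

Fact circle1_subproof : `|1 : R[i]| == 1. Proof. by rewrite normr1. Qed.

HB.instance Definition _ := isPointed.Build circle (Circle circle1_subproof).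

Definition coords (z : circle) : R * R := (complex.Re z, complex.Im z).

(* The Borel sigma-algebra of the circle, as a subspace of the plane. *)
HB.instance Definition _ :=
  Measurable.copy circle (g_sigma_algebra_preimageType coords).

Fact turn_subproof (t : R) :
  `|(cos (2 * pi * t) +i* sin (2 * pi * t)) : R[i]| == 1.
Proof. by rewrite normc_def /= cos2Dsin2 sqrtr1. Qed.

(* t |-> exp (2 i pi t) *)
Definition turn (t : R) : circle := Circle (turn_subproof t).

Fact measurable_turn : measurable_fun [set: R] turn.
Proof.
move=> _ _ [B mB <-]; rewrite !setTI -comp_preimage.
rewrite -[X in measurable X]setTI.
suff : measurable_fun setT (coords \o turn) by apply.
have m2 : measurable_fun [set: R] (fun t : R => 2 * pi * t).
  exact: mulrl_measurable.
apply/measurable_fun_pairP; split.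
- exact: measurableT_comp (continuous_measurable_fun (@continuous_cos R)) m2.
- exact: measurableT_comp (continuous_measurable_fun (@continuous_sin R)) m2.
Qed.

HB.instance Definition _ := isMeasurableFun.Build _ _ _ _ turn measurable_turn.

(* The normalized Lebesgue measure of the circle. *)
Definition circle_measure : set circle -> \bar R :=
  pushforward (mrestr (@lebesgue_measure R) (measurable_itv `[0, 1])) turn.

Let circle_measure0 : circle_measure set0 = 0%E.
Proof. by rewrite /circle_measure /pushforward preimage_set0 measure0. Qed.

Let circle_measure_ge0 A : (0 <= circle_measure A)%E.
Proof. by have mt := measurable_turn; exact: measure_ge0. Qed.

Let circle_measure_sigma_additive : semi_sigma_additive circle_measure.
Proof.
by have mt := measurable_turn; exact: measure_semi_sigma_additive.
Qed.

HB.instance Definition _ := isMeasure.Build _ _ _ circle_measure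
  circle_measure0 circle_measure_ge0 circle_measure_sigma_additive.

Let circle_measureT : circle_measure [set: circle] = 1%E.
Proof.
rewrite /circle_measure /pushforward preimage_setT /mrestr setTI.
by rewrite lebesgue_measure_itv /= lte01 oppr0 adde0.
Qed.

HB.instance Definition _ := Measure_isProbability.Build _ _ _ circle_measure
  circle_measureT.

End Circle.

Section Functions.
Variable R : realType.
Local Notation C := R[i].
Local Notation T := (circle R).
Local Notation m := (@circle_measure R).

Definition cmeasurable (f : T -> C) : Prop :=
  measurable_fun setT (fun zeta => complex.Re (f zeta)) /\
  measurable_fun setT (fun zeta => complex.Im (f zeta)).

Definition cintegral (f : T -> C) : C :=
  (\int[m]_zeta complex.Re (f zeta)) +i* (\int[m]_zeta complex.Im (f zeta)).

(* Lp-norm of a real-valued function *)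
Definition rLnorm (p : \bar R) (f : T -> R) : \bar R :=
  'N[m]_p [EFin \o f]%E.

Definition fourier_coef (f : T -> C) (n : int) : C :=
  cintegral (fun zeta => f zeta * (zeta : C) ^ (- n)).

(* The scalar Hardy space, for 1 <= p <= +oo. *)
Definition Hardy (p : \bar R) (f : T -> C) : Prop :=
  [/\ cmeasurable f,
      (rLnorm p (fun zeta => normc (f zeta)) < +oo)%E
    & forall n : int, n < 0 -> fourier_coef f n = 0].

Definition mx_measurable k l (F : T -> 'M[C]_(k, l)) : Prop :=
  forall i j, cmeasurable (fun zeta => F zeta i j).

Definition mx_Hardy k l (p : \bar R) (F : T -> 'M[C]_(k, l)) : Prop :=
  forall i j, Hardy p (fun zeta => F zeta i j).

Definition eucl_norm (x : 'cV[C]_2) : R :=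
  Num.sqrt (\sum_i normc (x i 0) ^+ 2).

Definition op_norm (M : 'M[C]_2) : R :=
  sup [set eucl_norm (M *m x) | x in [set x | eucl_norm x <= 1]].

Definition vLnorm (p : \bar R) (f : T -> 'cV[C]_2) : \bar R :=
  rLnorm p (fun zeta => eucl_norm (f zeta)).

Definition mxLnorm (p : \bar R) (Phi : T -> 'M[C]_2) : \bar R :=
  rLnorm p (fun zeta => op_norm (Phi zeta)).

Definition vLspace (p : \bar R) (f : T -> 'cV[C]_2) : Prop :=
  mx_measurable f /\ (vLnorm p f < +oo)%E.

Definition mxLspace (p : \bar R) (Phi : T -> 'M[C]_2) : Prop :=
  mx_measurable Phi /\ (mxLnorm p Phi < +oo)%E.

Definition inner (f g : T -> 'cV[C]_2) : C :=
  cintegral (fun zeta => \sum_i f zeta i 0 * (g zeta i 0)^*).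

Definition H2minus (g : T -> 'cV[C]_2) : Prop :=
  vLspace 2 g /\ forall h, mx_Hardy 2 h -> inner g h = 0.

(* Orthogonal projection of L2 onto H2minus; its value is determined only up
   to equality almost everywhere, and is meaningless outside L2. *)
Definition Pminus (f : T -> 'cV[C]_2) : T -> 'cV[C]_2 :=
  xget (cst 0)
    [set g | H2minus g /\ forall h, H2minus h -> inner (f \- g) h = 0].

Definition Hankel (Phi : T -> 'M[C]_2) (f : T -> 'cV[C]_2) : T -> 'cV[C]_2 :=
  Pminus (fun zeta => Phi zeta *m f zeta).

(* Norm of the Hankel operator from Hq to H2minus *)
Definition Hankel_norm (q : \bar R) (Phi : T -> 'M[C]_2) : \bar R :=
  ereal_sup [set vLnorm 2 (Hankel Phi f) |
    f in [set f | mx_Hardy q f /\ (vLnorm q f <= 1)%E]].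

Definition distH (p : \bar R) (Phi : T -> 'M[C]_2) : \bar R :=
  ereal_inf [set mxLnorm p (Phi \- F) | F in [set F | mx_Hardy p F]].

(* In the next two definitions q is the exponent with 1/p + 1/q = 1/2. *)
Definition respectable (p q : \bar R) (Phi : T -> 'M[C]_2) : Prop :=
  [/\ mxLspace p Phi, ~ mx_Hardy p Phi & Hankel_norm q Phi = distH p Phi].

Definition weird (p q : \bar R) (Phi : T -> 'M[C]_2) : Prop :=
  [/\ mxLspace p Phi, ~ mx_Hardy p Phi & ~ respectable p q Phi].

Definition badly_approximable (p : \bar R) (Phi : T -> 'M[C]_2) : Prop :=
  mxLspace p Phi /\ mxLnorm p Phi = distH p Phi.

Definition invertible_Hoo (F : T -> 'M[C]_2) : Prop :=
  [/\ mx_Hardy +oo%E F, {ae m, forall zeta, F zeta \in unitmx}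
    & mx_Hardy +oo%E (fun zeta => invmx (F zeta))].

(* Complex linear independence of four functions modulo almost everywhere
   equality *)
Definition lin_indep4 (f1 f2 f3 f4 : T -> C) : Prop :=
  forall c1 c2 c3 c4 : C,
  {ae m, forall zeta,
     c1 * f1 zeta + c2 * f2 zeta + c3 * f3 zeta + c4 * f4 zeta = 0} ->
  [/\ c1 = 0, c2 = 0, c3 = 0 & c4 = 0].

Definition mx22 (a b c d : C) : 'M[C]_2 :=
  \matrix_(i, j) if i == 0 then (if j == 0 then a else b)
                 else (if j == 0 then c else d).

End Functions.

(* Main.v *)
Require Import Defs.
From HB Require Import structures.
From mathcomp Require Import all_boot all_order all_algebra.
From mathcomp Require Import all_classical all_reals all_analysis.
From mathcomp Require Import complex measurable_realfun lebesgue_measure.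
From mathcomp Require Import ess_sup_inf ring lra.

Set Implicit Arguments.
Unset Strict Implicit.
Unset Printing Implicit Defensive.

Import Order.TTheory GRing.Theory Num.Theory.
Import numFieldNormedType.Exports ComplexField.Normc.

Local Open Scope classical_set_scope.
Local Open Scope ring_scope.
Local Open Scope complex_scope.

(* Since A^2 = Q Q^*, the function U is unitary-valued, so ||U||_p = 1.  As the
   trace norm of Q is tr A = tr B = 1 and tr (z Q U) = tr A, pairing U - F with
   z Q, F in H^p, gives 1 <= ||U - F||_1 <= ||U - F||_p: U is badly approximable.

   If ||H_U|| were 1, take f in the unit ball of H^q with g = H_U f of norm close
   to 1.  As z U = Q^* Psi^-* Psi^-1, the vector Psi^-1 f is analytic and differs
   by Psi^* Q^-* z (U f - g), which is small, from an antianalytic one; so f is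
   close in L^2 to Psi c for a constant vector c.  Because q > 2, the norms
   ||f||_q <= 1 and ||f||_2 ~ 1 force |f| ~ 1, hence c^* B c = |Psi c|^2 ~ 1 in
   L^1.  But c^* B c - 1 is a combination of alpha, beta, conj beta and 1 whose
   coefficients cannot all be small, which contradicts linear independence.

   No weak compactness is used, and the only input from Hardy space theory is that
   H^oo H^2 is contained in H^2 (in terms of Fourier coefficients), which follows
   from the density of the trigonometric polynomials in L^2. *)

(** * Complex-valued integration on the circle *)

(** The formula for [z U] comes from [Q^-1 A = Q^-1 A^2 A^-1 = Q^* A^-1]. The supremum that defines
    the Hankel norm need not be attained, so only near maximizers are at hand: every step may lose
    no more than a constant depending on [Psi], [Q] and [q], and the deficit [e] is chosen after all
    constants are known. For the same reason the lower bound on the L^1 distance from [c^* B c] to 1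
    has to be uniform over all constant vectors [c], an unbounded set. Two facts give it: linear
    independence bounds the coefficients of a combination by its L^1 norm, and these coefficients
    are tied by [|conj c_0 c_1|^2 = |c_0|^2 |c_1|^2], a relation that fails when all of them are
    near 0. Cauchy-Schwarz is used throughout in the form [2ab <= t a^2 + b^2 / t] with a free
    weight [t], which keeps square roots of integrals out of the estimates. *)

Section ComplexParts.
Variable R : realType.
Implicit Types z w : R[i].

Lemma ReD z w : complex.Re (z + w) = complex.Re z + complex.Re w.
Proof. by case: z w => [a b] [c d]. Qed.

Lemma ImD z w : complex.Im (z + w) = complex.Im z + complex.Im w.
Proof. by case: z w => [a b] [c d]. Qed.

Lemma ReN z : complex.Re (- z) = - complex.Re z.
Proof. by case: z => [a b]. Qed.

Lemma ImN z : complex.Im (- z) = - complex.Im z.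
Proof. by case: z => [a b]. Qed.

Lemma ReM z w : complex.Re (z * w) =
  complex.Re z * complex.Re w - complex.Im z * complex.Im w.
Proof. by case: z w => [a b] [c d]. Qed.

Lemma ImM z w : complex.Im (z * w) =
  complex.Re z * complex.Im w + complex.Im z * complex.Re w.
Proof. by case: z w => [a b] [c d]. Qed.

Lemma ReJ z : complex.Re z^* = complex.Re z.
Proof. by case: z. Qed.

Lemma ImJ z : complex.Im z^* = - complex.Im z.
Proof. by case: z. Qed.

Definition ReImE := (ReD, ImD, ReN, ImN, ReM, ImM, ReJ, ImJ).

(** The squared modulus, kept polynomial in the two parts so that identities and inequalities are
    within reach of [ring] and [nra]; [normc] hides a square root. *)
Definition sq z : R := complex.Re z ^+ 2 + complex.Im z ^+ 2.

Lemma sq_ge0 z : 0 <= sq z.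
Proof. by rewrite addr_ge0 ?sqr_ge0. Qed.

Lemma sqM z w : sq (z * w) = sq z * sq w.
Proof. by rewrite /sq !ReImE; ring. Qed.

Lemma sqJ z : sq z^* = sq z.
Proof. by rewrite /sq !ReImE; ring. Qed.

Lemma sqN z : sq (- z) = sq z.
Proof. by rewrite /sq !ReImE; ring. Qed.

Lemma sq0 : sq 0 = 0.
Proof. by rewrite /sq /= expr0n /= addr0. Qed.

Lemma sq1 : sq 1 = 1.
Proof. by rewrite /sq /= expr1n expr0n /= addr0. Qed.

Lemma sq_real (x : R) : sq x%:C = x ^+ 2.
Proof. by rewrite /sq /= expr0n /= addr0. Qed.

Lemma sq_eq0 z : sq z = 0 -> z = 0.
Proof.
case: z => a b; rewrite /sq /= => /eqP.
by rewrite paddr_eq0 ?sqr_ge0 // !sqrf_eq0 => /andP[/eqP-> /eqP->].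
Qed.

Lemma normcE2 z : normc z ^+ 2 = sq z.
Proof. by case: z => a b; rewrite /sq /= sqr_sqrtr // addr_ge0 ?sqr_ge0. Qed.

Lemma normc_ge0 z : 0 <= normc z.
Proof. by case: z => a b; rewrite sqrtr_ge0. Qed.

Lemma sqD_le z w : sq (z + w) <= 2 * sq z + 2 * sq w.
Proof.
rewrite /sq !ReImE.
have := sqr_ge0 (complex.Re z - complex.Re w).
have := sqr_ge0 (complex.Im z - complex.Im w).
nra.
Qed.

Lemma Re2_le z : complex.Re z ^+ 2 <= sq z.
Proof. by rewrite lerDl sqr_ge0. Qed.

Lemma Im2_le z : complex.Im z ^+ 2 <= sq z.
Proof. by rewrite lerDr sqr_ge0. Qed.

Lemma conj_mul z : z^*%C * z = (sq z)%:C.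
Proof.
case: z => a b; apply/eqP; rewrite eq_complex /sq /=.
by apply/andP; split; apply/eqP; ring.
Qed.

End ComplexParts.

Section RealIntegrals.
Variable R : realType.
Local Notation T := (circle R).
Local Notation m := (@circle_measure R).
Implicit Types f g : T -> R.

Definition rint f : Prop := m.-integrable setT (EFin \o f).

Lemma rint_measurable f : rint f -> measurable_fun setT f.
Proof. by move/measurable_int/measurable_EFinP. Qed.

Lemma rintD f g : rint f -> rint g -> rint (fun x => f x + g x).
Proof. by move=> hf hg; exact: (integrableD measurableT hf hg). Qed.

Lemma rintZ (k : R) f : rint f -> rint (fun x => k * f x).
Proof. by move=> hf; exact: (integrableZl measurableT k hf). Qed.

Lemma rintN f : rint f -> rint (fun x => - f x).
Proof. by move=> hf; exact: (integrableN hf). Qed.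

Lemma rintB f g : rint f -> rint g -> rint (fun x => f x - g x).
Proof. by move=> hf hg; apply: rintD => //; exact: rintN. Qed.

Lemma rint_cst (k : R) : rint (fun=> k).
Proof. by apply: (finite_measure_integrable_cst m k) => //; exact: measurableT. Qed.

Lemma rint_le f g : measurable_fun setT f -> (forall x, `|f x| <= g x) ->
  rint g -> rint f.
Proof.
move=> mf fg; apply: le_integrable => //; first exact/measurable_EFinP.
by move=> x _ /=; rewrite lee_fin (le_trans (fg x)) // ler_norm.
Qed.

Lemma rint_ae_le f g : measurable_fun setT f ->
  {ae m, forall x, `|f x| <= g x} -> rint g -> rint f.
Proof.
move=> mf fg ig; apply/integrableP; split; first exact/measurable_EFinP.
have /integrableP[mg] := ig; apply: le_lt_trans.
apply: ae_ge0_le_integral => //.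
- by apply: measurableT_comp => //; exact/measurable_EFinP.
- by apply: measurableT_comp => //; exact/measurable_EFinP.
- by apply: filterS fg => x h _ /=; rewrite lee_fin (le_trans h) // ler_norm.
Qed.

Local Notation I f := (\int[m]_x f x).

Lemma intD f g : rint f -> rint g -> \int[m]_x (f x + g x) = I f + I g.
Proof. by move=> hf hg; exact: RintegralD. Qed.

Lemma intB f g : rint f -> rint g -> \int[m]_x (f x - g x) = I f - I g.
Proof. by move=> hf hg; exact: RintegralB. Qed.

Lemma intZ (k : R) f : rint f -> \int[m]_x (k * f x) = k * I f.
Proof. by move=> hf; exact: RintegralZl. Qed.

Lemma intN f : rint f -> \int[m]_x (- f x) = - I f.
Proof.
move=> hf; rewrite -mulN1r -intZ //; apply: eq_Rintegral => x _.
by rewrite mulN1r.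
Qed.

Lemma int_cst (k : R) : \int[m]_x k = k.
Proof. by rewrite Rintegral_cst //= -/m probability_setT /= mulr1. Qed.

Lemma int_ge0 f : (forall x, 0 <= f x) -> 0 <= I f.
Proof. by move=> h; apply: Rintegral_ge0. Qed.

Lemma int_ae_eq f g : measurable_fun setT f -> measurable_fun setT g ->
  {ae m, forall x, f x = g x} -> I f = I g.
Proof.
move=> mf mg fg; congr fine; apply: ae_eq_integral => //.
- exact/measurable_EFinP.
- exact/measurable_EFinP.
- by apply: filterS fg => x -> _.
Qed.

Lemma int_ae_le f g : rint f -> rint g ->
  {ae m, forall x, f x <= g x} -> I f <= I g.
Proof.
(* The minimum with [g] agrees with [f] almost everywhere and lies below [g] everywhere, which turns
   the hypothesis into a pointwise inequality. *)
move=> hf hg fg; rewrite (@int_ae_eq f (fun x => Num.min (f x) (g x))).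
- apply: le_Rintegral => //; last by move=> x _; rewrite ge_min lexx orbT.
  apply: (@rint_le _ (fun x => `|f x| + `|g x|)).
  + by apply: measurable_minr; exact: rint_measurable.
  + move=> x; rewrite /Num.min; case: ifP => _; rewrite ?lerDl ?lerDr //.
  + by apply: rintD; exact: integrable_norm.
- exact: rint_measurable.
- by apply: measurable_minr; exact: rint_measurable.
- by apply: filterS fg => x h; rewrite min_l.
Qed.

Lemma int_le f g : rint f -> rint g -> (forall x, f x <= g x) -> I f <= I g.
Proof. by move=> hf hg fg; apply: int_ae_le => //; apply: aeW. Qed.

Lemma rint_EFin f : rint f -> (\int[m]_x (f x)%:E)%E = (I f)%:E.
Proof. by move=> hf; rewrite fineK //; exact: integrable_fin_num. Qed.

Lemma rint_lty f : measurable_fun setT f -> (forall x, 0 <= f x) ->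
  (\int[m]_x (f x)%:E < +oo)%E -> rint f.
Proof.
move=> mf f0 fy; apply/integrableP; split; first exact/measurable_EFinP.
by under eq_integral do rewrite /= ger0_norm //.
Qed.

Lemma int_eq0_ae f : rint f -> (forall x, 0 <= f x) -> I f = 0 ->
  {ae m, forall x, f x = 0}.
Proof.
move=> hf f0 If.
have mf : measurable_fun setT (EFin \o f).
  by apply/measurable_EFinP; exact: rint_measurable.
have h : (\int[m]_x `|(EFin \o f) x| = 0)%E.
  under eq_integral do rewrite /= ger0_norm //.
  by rewrite rint_EFin // If.
have /(_ h) := (ae_eq_integral_abs m measurableT mf).1.
by apply: filterS => x /(_ Logic.I) /= [].
Qed.

(** Dominated convergence, reduced to what the approximation arguments consume: one index with a
    small integral. *)
Lemma int_cvg0 (f_ : nat -> T -> R) g :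
  (forall n, measurable_fun setT (f_ n)) -> rint g ->
  (forall n x, 0 <= f_ n x <= g x) ->
  (forall x, f_ ^~ x @ \oo --> (0 : R)) ->
  forall e : R, 0 < e -> exists n, I (f_ n) <= e.
Proof.
move=> mf ig fg f0 e e0.
have rf n : rint (f_ n).
  apply: rint_le (ig) => // x; have /andP[h1 h2] := fg n x.
  by rewrite ger0_norm.
have h1 : {ae m, forall x, setT x -> (EFin \o f_ n) x @[n --> \oo] --> (0 : \bar R)%E}.
  by apply: aeW => x _; apply: cvg_EFin; [exact: nearW|exact: f0].
have h2 : {ae m, forall x n, setT x -> (`|(EFin \o f_ n) x| <= (EFin \o g) x)%E}.
  by apply: aeW => x n _; rewrite /= lee_fin; case/andP: (fg n x) => ? ?;
     rewrite ger0_norm.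
have [_ _] := dominated_convergence measurableT
  (fun n => (measurable_EFinP _ _).2 (mf n)) (measurable_cst 0%E) h1 ig h2.
rewrite integral0 => /fine_cvgP[_ /cvgrPdist_le /(_ e e0)] [n _ /(_ n (leqnn n))].
rewrite /= sub0r normrN => h; exists n; apply: le_trans h.
by rewrite ger0_norm //; apply: int_ge0 => x; case/andP: (fg n x).
Qed.

End RealIntegrals.

(** * Square-integrable and essentially bounded complex functions *)

Section ComplexIntegrals.
Variable R : realType.
Local Notation C := R[i].
Local Notation T := (circle R).
Local Notation m := (@circle_measure R).
Implicit Types f g h : T -> C.

Lemma cmeasurableD f g : cmeasurable f -> cmeasurable g ->
  cmeasurable (fun x => f x + g x).
Proof.
move=> [f1 f2] [g1 g2]; split.
- by under eq_fun do rewrite ReD; exact: measurable_funD.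
- by under eq_fun do rewrite ImD; exact: measurable_funD.
Qed.

Lemma cmeasurableN f : cmeasurable f -> cmeasurable (fun x => - f x).
Proof.
move=> [f1 f2]; split.
- by under eq_fun do rewrite ReN; exact: measurableT_comp.
- by under eq_fun do rewrite ImN; exact: measurableT_comp.
Qed.

Lemma cmeasurableB f g : cmeasurable f -> cmeasurable g ->
  cmeasurable (fun x => f x - g x).
Proof. by move=> mf mg; apply: cmeasurableD => //; exact: cmeasurableN. Qed.

Lemma cmeasurableM f g : cmeasurable f -> cmeasurable g ->
  cmeasurable (fun x => f x * g x).
Proof.
move=> [f1 f2] [g1 g2]; split.
- by under eq_fun do rewrite ReM; apply: measurable_funB; exact: measurable_funM.
- by under eq_fun do rewrite ImM; apply: measurable_funD; exact: measurable_funM.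
Qed.

Lemma cmeasurableJ f : cmeasurable f -> cmeasurable (fun x => (f x)^*).
Proof.
move=> [f1 f2]; split.
- by under eq_fun do rewrite ReJ.
- by under eq_fun do rewrite ImJ; exact: measurableT_comp.
Qed.

Lemma cmeasurable_cst (c : C) : cmeasurable (fun=> c).
Proof. by split; exact: measurable_cst. Qed.

Lemma cmeasurable_real (f : T -> R) : measurable_fun setT f ->
  cmeasurable (fun x => (f x)%:C).
Proof. by move=> mf; split => //; exact: measurable_cst. Qed.

Lemma cmeasurable_sum (I : Type) (s : seq I) (F : I -> T -> C) :
  (forall i, cmeasurable (F i)) -> cmeasurable (fun x => \sum_(i <- s) F i x).
Proof.
move=> mF; elim: s => [|i s IH].
  by under eq_fun do rewrite big_nil; exact: cmeasurable_cst.
by under eq_fun do rewrite big_cons; exact: cmeasurableD.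
Qed.

Lemma cmeasurableX f n : cmeasurable f -> cmeasurable (fun x => f x ^+ n).
Proof.
move=> mf; elim: n => [|n IH].
  by under eq_fun do rewrite expr0; exact: cmeasurable_cst.
by under eq_fun do rewrite exprS; exact: cmeasurableM.
Qed.

Lemma measurable_coords : measurable_fun [set: T] (@coords R).
Proof. by move=> _ A mA; rewrite setTI; exists A => //; rewrite setTI. Qed.

Lemma cmeasurable_z : cmeasurable (fun x : T => (x : C)).
Proof. exact: ((measurable_fun_pairP _).1 measurable_coords). Qed.

Lemma sq_circle (x : T) : sq (x : C) = 1.
Proof.
case: x => /= z; rewrite normc_def => /eqP [h].
have: Num.sqrt (sq z) ^+ 2 = 1 by rewrite /sq h expr1n.
by rewrite sqr_sqrtr // sq_ge0.
Qed.

Lemma circle_conjV (x : T) : (x : C)^* = (x : C)^-1.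
Proof.
have x0 : (x : C) != 0.
  by apply/eqP => x0; have := sq_circle x; rewrite x0 sq0 => /eqP; rewrite eq_sym oner_eq0.
by apply: (mulIf x0); rewrite conj_mul sq_circle mulVf.
Qed.

Lemma circle_unit (x : T) : (x : C) != 0.
Proof.
by apply/eqP => x0; have := sq_circle x; rewrite x0 sq0 => /eqP; rewrite eq_sym oner_eq0.
Qed.

Lemma cmeasurable_zexp (n : int) : cmeasurable (fun x : T => (x : C) ^ n).
Proof.
case: n => n; first exact: cmeasurableX cmeasurable_z.
under eq_fun do rewrite NegzE -exprz_inv -circle_conjV.
by apply: cmeasurableX; apply: cmeasurableJ; exact: cmeasurable_z.
Qed.

Lemma sq_zexp (x : T) (n : int) : sq ((x : C) ^ n) = 1.
Proof.
have H (w : C) (k : nat) : sq w = 1 -> sq (w ^+ k) = 1.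
  by move=> w1; elim: k => [|k IH]; rewrite ?expr0 ?sq1 // exprS sqM IH w1 mulr1.
case: n => n; first by apply: H; exact: sq_circle.
by rewrite NegzE -exprz_inv -circle_conjV; apply: H; rewrite sqJ sq_circle.
Qed.

Lemma measurable_sq f : cmeasurable f -> measurable_fun setT (fun x => sq (f x)).
Proof. by move=> [f1 f2]; apply: measurable_funD; exact: measurable_funX. Qed.

Lemma measurable_normc f : cmeasurable f ->
  measurable_fun setT (fun x => normc (f x)).
Proof.
move=> mf; under eq_fun => x.
  rewrite -[normc _]ger0_norm ?normc_ge0 // -sqrtr_sqr normcE2; over.
apply: measurableT_comp (measurable_sq mf).
exact: continuous_measurable_fun (@sqrt_continuous R).
Qed.

Definition L2 f : Prop := cmeasurable f /\ rint (fun x => sq (f x)).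

Definition ess_bounded f : Prop :=
  cmeasurable f /\ exists K : R, 0 <= K /\ {ae m, forall x, sq (f x) <= K}.

Definition cintegrable f : Prop :=
  rint (fun x => complex.Re (f x)) /\ rint (fun x => complex.Im (f x)).

Lemma L2D f g : L2 f -> L2 g -> L2 (fun x => f x + g x).
Proof.
move=> [mf hf] [mg hg]; split; first exact: cmeasurableD.
apply: (@rint_le _ _ (fun x => 2 * sq (f x) + 2 * sq (g x))).
- by apply: measurable_sq; exact: cmeasurableD.
- by move=> x; rewrite ger0_norm ?sq_ge0 // sqD_le.
- by apply: rintD; exact: rintZ.
Qed.

Lemma L2N f : L2 f -> L2 (fun x => - f x).
Proof.
move=> [mf hf]; split; first exact: cmeasurableN.
by under eq_fun do rewrite sqN.
Qed.

Lemma L2B f g : L2 f -> L2 g -> L2 (fun x => f x - g x).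
Proof. by move=> hf hg; apply: L2D => //; exact: L2N. Qed.

Lemma L2J f : L2 f -> L2 (fun x => (f x)^*).
Proof.
move=> [mf hf]; split; first exact: cmeasurableJ.
by under eq_fun do rewrite sqJ.
Qed.

Lemma ess_boundedM_L2 f g : ess_bounded f -> L2 g -> L2 (fun x => f x * g x).
Proof.
move=> [mf [K [K0 fK]]] [mg hg]; split; first exact: cmeasurableM.
apply: (@rint_ae_le _ _ (fun x => K * sq (g x))).
- by apply: measurable_sq; exact: cmeasurableM.
- apply: filterS fK => x h.
  by rewrite ger0_norm ?sq_ge0 // sqM ler_wpM2r // sq_ge0.
- exact: rintZ.
Qed.

Lemma ess_bounded_L2 f : ess_bounded f -> L2 f.
Proof.
move=> [mf [K [K0 fK]]]; split => //.
apply: (@rint_ae_le _ _ (fun=> K)); first exact: measurable_sq.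
- by apply: filterS fK => x h; rewrite ger0_norm ?sq_ge0.
- exact: rint_cst.
Qed.

Lemma ess_bounded_cst (c : C) : ess_bounded (fun=> c).
Proof.
split; first exact: cmeasurable_cst.
by exists (sq c); split; [exact: sq_ge0|exact: aeW].
Qed.

Lemma ess_bounded_zexp (n : int) : ess_bounded (fun x : T => (x : C) ^ n).
Proof.
split; first exact: cmeasurable_zexp.
by exists 1; split => //; apply: aeW => x; rewrite sq_zexp.
Qed.

Lemma ess_bounded_z : ess_bounded (fun x : T => (x : C)).
Proof. exact: (ess_bounded_zexp 1). Qed.

Lemma ess_boundedJ f : ess_bounded f -> ess_bounded (fun x => (f x)^*).
Proof.
move=> [mf [K [K0 fK]]]; split; first exact: cmeasurableJ.
by exists K; split => //; apply: filterS fK => x; rewrite sqJ.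
Qed.

Lemma L2Z (c : C) f : L2 f -> L2 (fun x => c * f x).
Proof. by move=> hf; apply: ess_boundedM_L2 => //; exact: ess_bounded_cst. Qed.

Lemma L2_cst (c : C) : L2 (fun=> c).
Proof. by apply: ess_bounded_L2; exact: ess_bounded_cst. Qed.

Lemma L2_cintegrableM f g : L2 f -> L2 g -> cintegrable (fun x => f x * g x).
Proof.
move=> [mf hf] [mg hg]; have [m1 m2] := cmeasurableM mf mg; split.
- apply: (@rint_le _ _ (fun x => sq (f x) + sq (g x))) => //; last exact: rintD.
  move=> x; rewrite ler_norml /sq !ReImE.
  have := sqr_ge0 (complex.Re (f x) - complex.Re (g x)).
  have := sqr_ge0 (complex.Re (f x) + complex.Re (g x)).
  have := sqr_ge0 (complex.Im (f x) - complex.Im (g x)).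
  have := sqr_ge0 (complex.Im (f x) + complex.Im (g x)).
  by move=> *; apply/andP; split; nra.
- apply: (@rint_le _ _ (fun x => sq (f x) + sq (g x))) => //; last exact: rintD.
  move=> x; rewrite ler_norml /sq !ReImE.
  have := sqr_ge0 (complex.Re (f x) - complex.Im (g x)).
  have := sqr_ge0 (complex.Re (f x) + complex.Im (g x)).
  have := sqr_ge0 (complex.Im (f x) - complex.Re (g x)).
  have := sqr_ge0 (complex.Im (f x) + complex.Re (g x)).
  by move=> *; apply/andP; split; nra.
Qed.

Lemma L2_cintegrable f : L2 f -> cintegrable f.
Proof.
by move=> hf; have := L2_cintegrableM hf (L2_cst 1); under eq_fun do rewrite mulr1.
Qed.

Lemma cintegrableD f g : cintegrable f -> cintegrable g -> cintegrable (fun x => f x + g x).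
Proof.
move=> [f1 f2] [g1 g2]; split.
- by under eq_fun do rewrite ReD; exact: rintD.
- by under eq_fun do rewrite ImD; exact: rintD.
Qed.

Lemma cintegrableZ (c : C) f : cintegrable f -> cintegrable (fun x => c * f x).
Proof.
move=> [f1 f2]; split.
- by under eq_fun do rewrite ReM; apply: rintB; exact: rintZ.
- by under eq_fun do rewrite ImM; apply: rintD; exact: rintZ.
Qed.

Lemma cintegrable_sum (I : Type) (s : seq I) (F : I -> T -> C) :
  (forall i, cintegrable (F i)) -> cintegrable (fun x => \sum_(i <- s) F i x).
Proof.
move=> mF; elim: s => [|i s IH].
  by under eq_fun do rewrite big_nil; exact: (L2_cintegrable (L2_cst 0)).
by under eq_fun do rewrite big_cons; exact: cintegrableD.
Qed.

Lemma Re_cintegral f :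
  complex.Re (cintegral f) = \int[m]_x complex.Re (f x).
Proof. by []. Qed.

Lemma Im_cintegral f :
  complex.Im (cintegral f) = \int[m]_x complex.Im (f x).
Proof. by []. Qed.

Lemma complex_ext (z w : C) :
  complex.Re z = complex.Re w -> complex.Im z = complex.Im w -> z = w.
Proof. by case: z w => [a b] [c d] /= -> ->. Qed.

Lemma cintegralD f g : cintegrable f -> cintegrable g ->
  cintegral (fun x => f x + g x) = cintegral f + cintegral g.
Proof.
move=> [f1 f2] [g1 g2]; apply: complex_ext.
- by rewrite ReD !Re_cintegral -intD //; apply: eq_Rintegral => x _; rewrite ReD.
- by rewrite ImD !Im_cintegral -intD //; apply: eq_Rintegral => x _; rewrite ImD.
Qed.

Lemma cintegralZ (c : C) f : cintegrable f ->
  cintegral (fun x => c * f x) = c * cintegral f.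
Proof.
move=> [f1 f2]; apply: complex_ext.
- rewrite ReM !(Re_cintegral, Im_cintegral) -!intZ // -intB; try exact: rintZ.
  by apply: eq_Rintegral => x _; rewrite ReM.
- rewrite ImM !(Re_cintegral, Im_cintegral) -!intZ // -intD; try exact: rintZ.
  by apply: eq_Rintegral => x _; rewrite ImM.
Qed.

Lemma cintegralB f g : cintegrable f -> cintegrable g ->
  cintegral (fun x => f x - g x) = cintegral f - cintegral g.
Proof.
move=> hf hg; under eq_fun do rewrite -mulN1r.
by rewrite cintegralD ?cintegralZ ?mulN1r //; exact: cintegrableZ.
Qed.

Lemma cintegralJ f : cintegrable f -> cintegral (fun x => (f x)^*) = (cintegral f)^*.
Proof.
move=> [f1 f2]; apply: complex_ext.
- by rewrite ReJ !Re_cintegral; apply: eq_Rintegral => x _; rewrite ReJ.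
- by rewrite ImJ !Im_cintegral -intN //; apply: eq_Rintegral => x _; rewrite ImJ.
Qed.

Lemma cintegral_cst (c : C) : cintegral (fun=> c) = c.
Proof. by apply: complex_ext; rewrite ?Re_cintegral ?Im_cintegral int_cst. Qed.

Lemma cintegral_sum (I : Type) (s : seq I) (F : I -> T -> C) :
  (forall i, cintegrable (F i)) ->
  cintegral (fun x => \sum_(i <- s) F i x) = \sum_(i <- s) cintegral (F i).
Proof.
move=> mF; elim: s => [|i s IH].
  by under eq_fun do rewrite big_nil; rewrite big_nil cintegral_cst.
under eq_fun do rewrite big_cons.
by rewrite big_cons cintegralD ?IH //; exact: cintegrable_sum.
Qed.

Lemma cintegral_ae_eq f g : cmeasurable f -> cmeasurable g ->
  {ae m, forall x, f x = g x} -> cintegral f = cintegral g.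
Proof.
move=> [f1 f2] [g1 g2] fg; apply: complex_ext; rewrite ?Re_cintegral ?Im_cintegral.
- by apply: int_ae_eq => //; apply: filterS fg => x ->.
- by apply: int_ae_eq => //; apply: filterS fg => x ->.
Qed.

(** Cauchy-Schwarz with a free weight, by completing the square pointwise. A large [t] suits a small
    [f] paired with a fixed [g]. *)
Lemma Re_cintegralM_le f g (t : R) : L2 f -> L2 g -> 0 < t ->
  2 * complex.Re (cintegral (fun x => f x * g x)) <=
  t * (\int[m]_x sq (f x)) + t^-1 * (\int[m]_x sq (g x)).
Proof.
move=> hf hg t0; have [h1 h2] := L2_cintegrableM hf hg.
rewrite Re_cintegral -!intZ //; [|exact: hg.2|exact: hf.2].
rewrite -intD; [|exact: (rintZ _ hf.2)|exact: (rintZ _ hg.2)].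
apply: int_le; first exact: rintZ.
  by apply: rintD; apply: rintZ; [exact: hf.2|exact: hg.2].
move=> x; rewrite ReM /sq.
set a := complex.Re (f x); set b := complex.Im (f x).
set c := complex.Re (g x); set d := complex.Im (g x).
have -> : t * (a ^+ 2 + b ^+ 2) + t^-1 * (c ^+ 2 + d ^+ 2) =
  2 * (a * c - b * d) + t^-1 * ((t * a - c) ^+ 2 + (t * b + d) ^+ 2).
  by field; rewrite gt_eqF.
by rewrite lerDl mulr_ge0 ?invr_ge0 ?(ltW t0) // addr_ge0 ?sqr_ge0.
Qed.

End ComplexIntegrals.

(** * Integrals of the powers of [z] *)

Section CircleMoments.
Variable R : realType.
Local Notation C := R[i].
Local Notation T := (circle R).
Local Notation m := (@circle_measure R).
Local Notation leb := (@lebesgue_measure R).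
Local Notation mI := (mrestr leb (measurable_itv `[0%R, 1%R])).

Lemma Rintegral_circle (f : T -> R) : rint f ->
  \int[m]_x f x = \int[leb]_(t in `[0, 1]) f (turn t).
Proof.
move=> hf; have mt := @measurable_turn R.
have mf : measurable_fun setT (EFin \o f).
  by apply/measurable_EFinP; exact: rint_measurable.
have E : forall g : T -> \bar R,
    (\int[m]_x g x = \int[pushforward mI (@turn R)]_x g x)%E.
  by move=> g; apply: eq_measure_integral.
have h1 : mI.-integrable setT (EFin \o f \o @turn R).
  apply/integrableP; split; first exact: measurableT_comp.
  have /integrableP[_] := hf; rewrite E ge0_integral_pushforward //.
  exact: measurableT_comp.
congr fine; rewrite E integral_pushforward //=.
(* The restricted measure lives on the whole line and gives no mass to the complement of [0, 1], so
   the integral can be cut down to that interval. *)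
have mN := measurableC
  (measurable_itv `[0%R, 1%R] : measurable (_ : set (measurableTypeR R))).
rewrite (@negligible_integral _ _ _ _ _ _ _ mN _ h1) //.
  by rewrite setTD setCK; apply: eq_measure_integral => A mA sA; rewrite /= /mrestr setIidl.
by rewrite /= /mrestr setICl measure0.
Qed.

Lemma turnX (t : R) (n : nat) : (turn t : C) ^+ n =
  cos (2 * pi * n%:R * t) +i* sin (2 * pi * n%:R * t).
Proof.
elim: n => [|n IH]; first by rewrite expr0 mulr0 mul0r cos0 sin0.
rewrite exprS IH /=.
have -> : 2 * pi * n.+1%:R * t = 2 * pi * t + 2 * pi * n%:R * t.
  by rewrite -[n.+1]addn1 natrD; ring.
by rewrite cosD sinD; apply: complex_ext; rewrite ?ReM ?ImM /=; ring.
Qed.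

Lemma FTC2_loop (F f : R -> R) : F 0 = F 1 -> continuous f ->
  (forall x, is_derive (x : R) (1 : R) F (f x)) -> \int[leb]_(t in `[0, 1]) f t = 0.
Proof.
move=> F01 cf dF; have cF : continuous F.
  by move=> x; apply/differentiable_continuous/derivable1_diffP; have [] := dF x.
rewrite /Rintegral (@continuous_FTC2 _ _ F) //.
- by rewrite F01 subee.
- exact: continuous_subspaceT.
- split.
  + by move=> x _; have [] := dF x.
  + by apply: cvg_at_right_filter; exact: cF.
  + by apply: cvg_at_left_filter; exact: cF.
- by move=> x _; rewrite derive1E; have [_ ->] := dF x.
Qed.

Lemma sin_2pi_nat (n : nat) : sin (2 * pi * n%:R) = 0 :> R.
Proof.
elim: n => [|n IH]; first by rewrite mulr0 sin0.
have -> : 2 * pi * n.+1%:R = 2 * pi * n%:R + pi *+ 2 :> R.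
  by rewrite -[n.+1]addn1 natrD mulr2n; ring.
by rewrite sinD2pi.
Qed.

Lemma cos_2pi_nat (n : nat) : cos (2 * pi * n%:R) = 1 :> R.
Proof.
elim: n => [|n IH]; first by rewrite mulr0 cos0.
have -> : 2 * pi * n.+1%:R = 2 * pi * n%:R + pi *+ 2 :> R.
  by rewrite -[n.+1]addn1 natrD mulr2n; ring.
by rewrite cosD2pi.
Qed.

(** Along [turn] the two parts are the cosine and sine of [w t] with [w = 2 pi (n + 1)]; their
    primitives take equal values at 0 and 1. *)
Lemma cintegral_zX (n : nat) : cintegral (fun x : T => (x : C) ^+ n.+1) = 0.
Proof.
have [h1 h2] := L2_cintegrable (ess_bounded_L2 (ess_bounded_zexp R n.+1)).
pose w : R := 2 * pi * n.+1%:R.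
have w0 : w != 0 by rewrite !mulf_neq0 ?pnatr_eq0 // gt_eqF ?pi_gt0.
have dm (x : R) : is_derive x (1 : R) ( *%R w : R -> R) w.
  have := is_deriveZ w (is_derive_id x (1 : R)).
  by rewrite /GRing.scale /= mulr1.
have cm : continuous ( *%R w : R -> R) by exact: mulrl_continuous.
apply: complex_ext; rewrite ?Re_cintegral ?Im_cintegral Rintegral_circle //.
- under eq_Rintegral do rewrite turnX /= -/w.
  apply: (@FTC2_loop (fun t => w^-1 * sin (w * t))).
  + by rewrite mulr0 mulr1 sin0 sin_2pi_nat.
  + by move=> x; apply: continuous_comp; [exact: cm|exact: continuous_cos].
  + move=> x; have d1 := is_derive1_comp (is_derive_sin (w * x)) (dm x).
    have := is_deriveZ w^-1 d1; rewrite /GRing.scale /= => d2.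
    by apply: is_derive_eq; rewrite [_ * w]mulrC mulKf.
- under eq_Rintegral do rewrite turnX /= -/w.
  apply: (@FTC2_loop (fun t => - w^-1 * cos (w * t))).
  + by rewrite mulr0 mulr1 cos0 cos_2pi_nat.
  + by move=> x; apply: continuous_comp; [exact: cm|exact: continuous_sin].
  + move=> x; have d1 := is_derive1_comp (is_derive_cos (w * x)) (dm x).
    have := is_deriveZ (- w^-1) d1; rewrite /GRing.scale /= => d2.
    by apply: is_derive_eq; rewrite mulNr mulNr mulrN opprK [_ * w]mulrC mulKf.
Qed.

Lemma circle_conj_exp (x : T) (n : int) : ((x : C) ^ n)^* = (x : C) ^ (- n).
Proof. by rewrite fmorphXz /= circle_conjV exprz_inv. Qed.

Lemma cintegral_zexp (n : int) : n != 0 ->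
  cintegral (fun x : T => (x : C) ^ n) = 0.
Proof.
case: n => [[//|n] _|n _]; first exact: cintegral_zX.
have -> : (fun x : T => (x : C) ^ Negz n) = (fun x : T => ((x : C) ^+ n.+1)^*).
  apply/funext => x; rewrite NegzE -exprz_inv -circle_conjV -exprnP.
  by rewrite rmorphXn.
rewrite cintegralJ ?cintegral_zX ?conjc0 //.
exact: (L2_cintegrable (ess_bounded_L2 (ess_bounded_zexp R n.+1))).
Qed.

End CircleMoments.

(** * Density of the trigonometric polynomials *)

Section SteepPolynomials.
Variable R : realType.
Implicit Types t y : R.

Lemma expr_1D_ge t (n : nat) : 0 <= t -> 1 + n%:R * t <= (1 + t) ^+ n.
Proof.
move=> t0; elim: n => [|n IH]; first by rewrite mul0r addr0 expr0.
rewrite exprS -[n.+1]addn1 natrD.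
have h : 0 <= n%:R :> R by [].
have := ler_wpM2l (_ : 0 <= 1 + t) IH; rewrite addr_ge0 // => /(_ isT).
nra.
Qed.

Lemma expr_1B_ge t (n : nat) : 0 <= t <= 1 -> 1 - n%:R * t <= (1 - t) ^+ n.
Proof.
move=> /andP[t0 t1]; elim: n => [|n IH]; first by rewrite mul0r subr0 expr0.
rewrite exprS -[n.+1]addn1 natrD.
have h : 0 <= n%:R :> R by [].
have := ler_wpM2l (_ : 0 <= 1 - t) IH; rewrite subr_ge0 => /(_ t1).
nra.
Qed.

(** From [(1 - t) (1 + t) <= 1] and Bernoulli's inequality for [(1 + t)^n]. *)
Lemma expr_1B_le t (n : nat) : 0 <= t <= 1 -> (1 - t) ^+ n <= (1 + n%:R * t)^-1.
Proof.
move=> /andP[t0 t1].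
have p0 : 0 < 1 + n%:R * t by rewrite ltr_pwDl // mulr_ge0.
rewrite -[leRHS]mul1r ler_pdivlMr //.
apply: (@le_trans _ _ ((1 - t) ^+ n * (1 + t) ^+ n)).
  by rewrite ler_wpM2l ?exprn_ge0 ?subr_ge0 // expr_1D_ge.
rewrite -exprMn exprn_ile1 //; first by rewrite mulr_ge0 ?subr_ge0 ?addr_ge0.
by nra.
Qed.

(* The exponent is chosen so that the limit is 0 at the threshold 1/2 too. *)
Definition steep (n : nat) y : R := (1 - y ^+ n) ^+ (n * 2 ^ n).

Lemma steep_ge0 n y : 0 <= y <= 1 -> 0 <= steep n y.
Proof. by move=> /andP[h1 h2]; rewrite exprn_ge0 // subr_ge0 exprn_ile1. Qed.

Lemma steep_le1 n y : 0 <= y <= 1 -> steep n y <= 1.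
Proof.
by move=> /andP[h1 h2]; rewrite exprn_ile1 // ?subr_ge0 ?exprn_ile1 // gerBl exprn_ge0.
Qed.

(** With [s = sqrt r], write [n r^n = (n s^n) s^n]; the bound on powers of [1 - (1 - s)] keeps the
    first factor below [1 / (1 - s)]. *)
Lemma cvg_n_geometric r : 0 <= r < 1 -> n%:R * r ^+ n @[n --> \oo] --> (0 : R).
Proof.
move=> /andP[r0 r1].
set s := Num.sqrt r; have s0 : 0 <= s by exact: sqrtr_ge0.
have s2 : s ^+ 2 = r by rewrite sqr_sqrtr.
have s1 : s < 1 by rewrite -(ltr_pXn2r (ltn0Sn 1)) ?nnegrE // s2 expr1n.
have d0 : 0 < 1 - s by rewrite subr_gt0.
have bnd n : n%:R * s ^+ n <= (1 - s)^-1.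
  have -> : s = 1 - (1 - s) by ring.
  apply: (@le_trans _ _ (n%:R * (1 + n%:R * (1 - s))^-1)).
    by apply: ler_wpM2l => //; apply: expr_1B_le; rewrite ltW //= gerBl.
  have -> : 1 - (1 - (1 - s)) = 1 - s by ring.
  rewrite ler_pdivrMr ?ltr_pwDl ?mulr_ge0 ?(ltW d0) // mulrDr mulr1 mulrCA.
  by rewrite mulVf ?gt_eqF // mulr1 lerDr invr_ge0 ltW.
apply: (@squeeze_cvgr _ _ _ _ (cst 0) (geometric (1 - s)^-1 s)).
- apply: nearW => n /=; rewrite mulr_ge0 ?exprn_ge0 //= -s2 -exprM mul2n -addnn.
  by rewrite exprD mulrA ler_wpM2r ?exprn_ge0.
- exact: cvg_cst.
- by apply: cvg_geometric; rewrite ger0_norm.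
Qed.

(** Below the threshold Bernoulli gives at least [1 - n (2y)^n], with [2y < 1]. From the threshold
    on, [(2y)^n >= 1] gives at most [1 / (1 + n)]. *)
Lemma steep_cvg y : 0 <= y <= 1 ->
  steep n y @[n --> \oo] --> ((y < 1/2)%R%:R : R).
Proof.
move=> /andP[y0 y1].
have yn n : 0 <= y ^+ n <= 1 by rewrite exprn_ge0 //= exprn_ile1.
case: ltP => h.
- apply: (@squeeze_cvgr _ _ _ _ (fun n => 1 - n%:R * (2 * y) ^+ n) (cst 1)).
  + apply: nearW => n; rewrite steep_le1 ?y0 // andbT.
    apply: le_trans (expr_1B_ge _ (yn n)).
    by rewrite natrM natrX exprMn mulrA.
  + rewrite -[X in _ --> X]subr0; apply: cvgB; first exact: cvg_cst.
    by apply: cvg_n_geometric; apply/andP; split; lra.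
  + exact: cvg_cst.
- apply: (@squeeze_cvgr _ _ _ _ (cst 0) (@harmonic R)).
  + apply: nearW => n; rewrite steep_ge0 ?y0 //=.
    apply: le_trans (expr_1B_le _ (yn n)) _.
    rewrite /harmonic lef_pV2 ?posrE ?ltr_pwDl ?mulr_ge0 ?(andP (yn n)).1 //.
    rewrite -natr1 addrC lerD2l natrM natrX -mulrA -exprMn.
    by rewrite ler_peMr // exprn_ege1 //; lra.
  + exact: cvg_cst.
  + exact: cvg_harmonic.
Qed.

End SteepPolynomials.

(** * From rays to Borel sets to square-integrable functions *)

Section TrigonometricDensity.
Variable R : realType.
Local Notation C := R[i].
Local Notation T := (circle R).
Local Notation m := (@circle_measure R).
Implicit Types (f g : T -> C) (s : seq (int * C)).

(** Exponents may repeat in the list, so that adding polynomials is concatenating lists. *)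
Definition trig s (x : T) : C := \sum_(a <- s) a.2 * (x : C) ^ a.1.

Definition is_trig f : Prop := exists s, f = trig s.

Lemma is_trig_cst (c : C) : is_trig (fun=> c).
Proof.
by exists [:: (0, c)]; apply/funext => x; rewrite /trig big_seq1 expr0z mulr1.
Qed.

Lemma is_trigD f g : is_trig f -> is_trig g -> is_trig (fun x => f x + g x).
Proof.
move=> [s ->] [t ->]; exists (s ++ t).
by apply/funext => x; rewrite /trig big_cat.
Qed.

Lemma is_trigM f g : is_trig f -> is_trig g -> is_trig (fun x => f x * g x).
Proof.
move=> [s ->] [t ->].
exists [seq (a.1 + b.1, a.2 * b.2) | a <- s, b <- t]; apply/funext => x.
rewrite /trig big_distrlr /= big_allpairs_dep /=.
apply: eq_bigr => a _; apply: eq_bigr => b _.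
by rewrite expfzDr ?circle_unit // mulrACA.
Qed.

Lemma is_trigX f n : is_trig f -> is_trig (fun x => f x ^+ n).
Proof.
move=> hf; elim: n => [|n IH].
  by under eq_fun do rewrite expr0; exact: is_trig_cst.
by under eq_fun do rewrite exprS; exact: is_trigM.
Qed.

Lemma is_trig_zexp (n : int) : is_trig (fun x => (x : C) ^ n).
Proof. by exists [:: (n, 1)]; apply/funext => x; rewrite /trig big_seq1 mul1r. Qed.

Lemma is_trig_Re : is_trig (fun x => (complex.Re (x : C))%:C).
Proof.
have -> : (fun x : T => (complex.Re (x : C))%:C) =
    (fun x : T => (1/2)%:C * ((x : C) ^ 1 + (x : C) ^ (-1))).
  apply/funext => x; rewrite expr1z exprN1 -circle_conjV.
  by apply: complex_ext; rewrite !ReImE /=; field.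
by apply: is_trigM; [exact: is_trig_cst|apply: is_trigD; exact: is_trig_zexp].
Qed.

Lemma is_trig_Im : is_trig (fun x => (complex.Im (x : C))%:C).
Proof.
have -> : (fun x : T => (complex.Im (x : C))%:C) =
    (fun x : T => (0 +i* (- (1/2))) * ((x : C) ^ 1 + (-1) * (x : C) ^ (-1))).
  apply/funext => x; rewrite expr1z exprN1 -circle_conjV.
  by apply: complex_ext; rewrite !ReImE /=; field.
apply: is_trigM; first exact: is_trig_cst.
by apply: is_trigD; [|apply: is_trigM; first exact: is_trig_cst]; exact: is_trig_zexp.
Qed.

Lemma trig_bounded s : exists K : R, 0 <= K /\ forall x, sq (trig s x) <= K.
Proof.
elim: s => [|[n c] s [K [K0 hK]]].
  by exists 0; split => // x; rewrite /trig big_nil sq0.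
exists (2 * sq c + 2 * K); split; first by rewrite addr_ge0 ?mulr_ge0 ?sq_ge0.
move=> x; rewrite /trig big_cons /=; apply: le_trans (sqD_le _ _) _.
by rewrite sqM sq_zexp mulr1 lerD2l ler_wpM2l // hK.
Qed.

Lemma trig_essb s : ess_bounded (trig s).
Proof.
have [K [K0 hK]] := trig_bounded s.
split; last by exists K; split => //; exact: aeW.
apply: (@cmeasurable_sum R _ s (fun (a : int * C) (x : T) => a.2 * (x : C) ^ a.1)) => a.
by apply: cmeasurableM; [exact: cmeasurable_cst|exact: cmeasurable_zexp].
Qed.

Lemma is_trig_essb f : is_trig f -> ess_bounded f.
Proof. by move=> [s ->]; exact: trig_essb. Qed.

(** Membership in the L^2 closure of the trigonometric polynomials; density is reached by enlarging
    this class step by step. *)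
Definition trig_approx f : Prop := L2 f /\
  forall e : R, 0 < e -> exists s, \int[m]_x sq (f x - trig s x) <= e.

Lemma trig_approx_istp f : is_trig f -> trig_approx f.
Proof.
move=> hf; split; first exact/ess_bounded_L2/is_trig_essb.
move=> e e0; have [s fs] := hf; exists s; rewrite fs.
by under eq_Rintegral do rewrite subrr sq0; rewrite int_cst ltW.
Qed.

Lemma L2_sq f : L2 f -> rint (fun x => sq (f x)). Proof. by case. Qed.

Lemma trig_approx_lim f : L2 f ->
  (forall e : R, 0 < e -> exists g, trig_approx g /\ \int[m]_x sq (f x - g x) <= e) ->
  trig_approx f.
Proof.
move=> hf H; split => // e e0.
(* A quarter each, because [sqD_le] doubles both errors. *)
have e40 : 0 < e / 4 by rewrite divr_gt0.
have [g [[hg Hg] fg]] := H _ e40; have [s gs] := Hg _ e40; exists s.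
have hs := ess_bounded_L2 (trig_essb s).
apply: (@le_trans _ _ (\int[m]_x (2 * sq (f x - g x) + 2 * sq (g x - trig s x)))).
  apply: int_le.
  - exact/L2_sq/L2B.
  - by apply: rintD; apply: rintZ; exact/L2_sq/L2B.
  - move=> x; have -> : f x - trig s x = (f x - g x) + (g x - trig s x) by ring.
    exact: sqD_le.
rewrite intD; try by apply: rintZ; exact/L2_sq/L2B.
by rewrite !intZ; try exact/L2_sq/L2B; lra.
Qed.

Lemma trig_approxD f g : trig_approx f -> trig_approx g -> trig_approx (fun x => f x + g x).
Proof.
move=> [hf Hf] [hg Hg]; split; first exact: L2D.
move=> e e0; have e40 : 0 < e / 4 by rewrite divr_gt0.
have [s fs] := Hf _ e40; have [t gt] := Hg _ e40.
have hs := ess_bounded_L2 (trig_essb s); have ht := ess_bounded_L2 (trig_essb t).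
exists (s ++ t).
apply: (@le_trans _ _ (\int[m]_x (2 * sq (f x - trig s x) + 2 * sq (g x - trig t x)))).
  have E x : f x + g x - trig (s ++ t) x = (f x - trig s x) + (g x - trig t x).
    by rewrite {1}/trig big_cat /= -/(trig s x) -/(trig t x); ring.
  under eq_Rintegral do rewrite E.
  apply: int_le.
  - by apply: L2_sq; apply: L2D; exact: L2B.
  - by apply: rintD; apply: rintZ; exact/L2_sq/L2B.
  - by move=> x; exact: sqD_le.
rewrite intD; try by apply: rintZ; exact/L2_sq/L2B.
by rewrite !intZ; try exact/L2_sq/L2B; lra.
Qed.

Lemma trig_approx_tpM f g : is_trig f -> trig_approx g -> trig_approx (fun x => f x * g x).
Proof.
move=> hf [hg Hg]; have := hf => -[t ft].
have [K [K0 hK]] := trig_bounded t; apply: trig_approx_lim.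
  by apply: ess_boundedM_L2 => //; exact: is_trig_essb.
move=> e e0; have ek : 0 < e / (K + 1) by rewrite divr_gt0 // ltr_pwDr.
have [s gs] := Hg _ ek; have hs := ess_bounded_L2 (trig_essb s).
exists (fun x => f x * trig s x); split.
  by apply: trig_approx_istp; apply: is_trigM => //; exists s.
apply: (@le_trans _ _ (\int[m]_x ((K + 1) * sq (g x - trig s x)))).
  apply: int_le; last first.
  - move=> x; rewrite -mulrBr sqM ler_wpM2r ?sq_ge0 // ft.
    by rewrite (le_trans (hK x)) // lerDl.
  - by apply: rintZ; exact/L2_sq/L2B.
  - by apply: L2_sq; apply: L2B; apply: ess_boundedM_L2 => //; exact: is_trig_essb.
rewrite intZ; last exact/L2_sq/L2B.
by rewrite mulrC -ler_pdivlMr // ltr_pwDr.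
Qed.

Lemma trig_approxZ (c : C) g : trig_approx g -> trig_approx (fun x => c * g x).
Proof. by move=> hg; apply: trig_approx_tpM => //; exact: is_trig_cst. Qed.

Lemma trig_approxM f g (K : R) : 0 <= K -> (forall x, sq (g x) <= K) ->
  trig_approx f -> trig_approx g -> trig_approx (fun x => f x * g x).
Proof.
move=> K0 hK [hf Hf] hg.
have bg : ess_bounded g by split; [exact: hg.1.1|exists K; split => //; exact: aeW].
have E h : (fun x => h x * g x) = (fun x => g x * h x).
  by apply/funext => x; rewrite mulrC.
apply: trig_approx_lim; first by rewrite E; exact: ess_boundedM_L2.
move=> e e0; have ek : 0 < e / (K + 1) by rewrite divr_gt0 // ltr_pwDr.
have [s gs] := Hf _ ek; have hs := ess_bounded_L2 (trig_essb s).
exists (fun x => trig s x * g x); split.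
  by apply: trig_approx_tpM => //; exists s.
apply: (@le_trans _ _ (\int[m]_x ((K + 1) * sq (f x - trig s x)))).
  apply: int_le; last first.
  - move=> x; rewrite -mulrBl sqM mulrC ler_wpM2r ?sq_ge0 //.
    by rewrite (le_trans (hK x)) // lerDl.
  - by apply: rintZ; exact/L2_sq/L2B.
  - by apply: L2_sq; apply: L2B; rewrite E; exact: ess_boundedM_L2.
rewrite intZ; last exact/L2_sq/L2B.
by rewrite mulrC -ler_pdivlMr // ltr_pwDr.
Qed.

Lemma trig_approx_cvg f (f_ : nat -> T -> C) (G : T -> R) : L2 f ->
  (forall n, trig_approx (f_ n)) -> rint G ->
  (forall n x, sq (f x - f_ n x) <= G x) ->
  (forall x, sq (f x - f_ n x) @[n --> \oo] --> (0 : R)) -> trig_approx f.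
Proof.
move=> hf hf_ hG fG ff; apply: trig_approx_lim => // e e0.
have ms n : measurable_fun setT (fun x => sq (f x - f_ n x)).
  by apply/measurable_sq/cmeasurableB; [exact: hf.1|exact: (hf_ n).1.1].
have sG n x : 0 <= sq (f x - f_ n x) <= G x by rewrite sq_ge0 fG.
by have [n hn] := int_cvg0 ms hG sG ff e0; exists (f_ n).
Qed.

Definition cindic (A : set T) (x : T) : C := (\1_A x)%:C.

Lemma L2_indic (A : set T) : measurable A -> L2 (fun x => cindic A x).
Proof.
move=> mA; apply: ess_bounded_L2; split.
  by apply: cmeasurable_real; exact: measurable_indic.
exists 1; split => //; apply: aeW => x; rewrite /cindic sq_real indicE.
by case: (_ \in _); rewrite ?expr1n ?expr0n.
Qed.

Lemma cvg_sq_dist (u v : nat -> R) (l : R) :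
  (forall n, v n = (l - u n) ^+ 2) -> u n @[n --> \oo] --> l ->
  v n @[n --> \oo] --> (0 : R).
Proof.
move=> vE ul; rewrite (_ : v = fun n => (l - u n) ^+ 2); last exact/funext.
have h : l - u n @[n --> \oo] --> (0 : R).
  have c : (fun _ : nat => l) @ \oo --> l by exact: cvg_cst.
  by rewrite -[X in _ --> X](subrr l); exact: (cvgB c ul).
rewrite -[X in _ --> X](mulr0 0); exact: (cvgM h h).
Qed.

(** An affine change of variable sends [u] into [0, 1] and [a] to 1/2. Then [steep n] of it is a
    trigonometric polynomial, bounded by 1, converging everywhere to the indicator. *)
Lemma trig_approx_ray (u : T -> R) (a : R) : is_trig (fun x => (u x)%:C) ->
  measurable_fun setT u ->
  (forall x, `|u x| <= 1) -> trig_approx (fun x => cindic (u @^-1` `]-oo, a[) x).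
Proof.
move=> hu mu u1; set A := u @^-1` _.
have mA : measurable A by rewrite -[A]setTI; apply: mu => //; exact: measurable_itv.
(* As [|u| <= 1], this is at least [2 |u - a|], which keeps [y] within 1/2 of its centre 1/2. *)
pose d : R := 2 * (1 + `|a|); have d0 : 0 < d by rewrite mulr_gt0 // ltr_pwDl.
pose y x := 1/2 + (u x - a) / d.
have y01 x : 0 <= y x <= 1.
  have := u1 x; have := ler_norm a; have := ler_norm (- a); rewrite normrN ler_norml.
  move=> h1 h2 /andP[h3 h4].
  have h5 : (u x - a) / d <= 1/2 by rewrite ler_pdivrMr // /d; lra.
  have h6 : - (1/2) <= (u x - a) / d by rewrite ler_pdivlMr // /d; lra.
  by apply/andP; split; rewrite /y; lra.
have Ay x : \1_A x = (y x < 1/2)%R%:R :> R.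
  rewrite indicE /A; congr (_ %:R); congr nat_of_bool.
  rewrite /y gtrDl pmulr_llt0 ?invr_gt0 // subr_lt0.
  by apply/idP/idP; rewrite ?inE /= in_itv.
apply: (@trig_approx_cvg _ (fun n x => (steep n (y x))%:C) (fun=> 1)).
- exact: L2_indic.
- move=> n; apply: trig_approx_istp.
  have -> : (fun x => (steep n (y x))%:C) =
     (fun x => (1 + (-1) * ((1/2 - a / d)%:C + (d^-1)%:C * (u x)%:C) ^+ n) ^+ (n * 2 ^ n)).
    apply/funext => x.
    have <- : (y x)%:C = (1/2 - a / d)%:C + (d^-1)%:C * (u x)%:C.
      by rewrite -rmorphM -rmorphD /= /y; congr (_ %:C); rewrite mulrBl; ring.
    by rewrite /steep rmorphXn rmorphB rmorph1 rmorphXn mulN1r.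
  apply: is_trigX; apply: is_trigD; first exact: is_trig_cst.
  apply: is_trigM; first exact: is_trig_cst.
  apply: is_trigX; apply: is_trigD; first exact: is_trig_cst.
  by apply: is_trigM => //; exact: is_trig_cst.
- exact: rint_cst.
- move=> n x; rewrite /cindic -rmorphB sq_real Ay -real_normK ?num_real //.
  rewrite expr_le1 // ler_norml.
  have := steep_ge0 n (y01 x); have := steep_le1 n (y01 x).
  by case: (_ < _) => /= h1 h2; apply/andP; split; lra.
- move=> x; apply: cvg_sq_dist (steep_cvg (y01 x)) => n.
  by rewrite /cindic -rmorphB sq_real Ay.
Qed.

Lemma trig_approx_indicC (A : set T) : trig_approx (fun x => cindic A x) ->
  trig_approx (fun x => cindic (~` A) x).
Proof.
move=> hA.
have -> : (fun x => cindic (~` A) x) = (fun x => 1 + (-1) * cindic A x).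
  apply/funext => x; rewrite /cindic !indicE in_setC.
  by case: (_ \in _); rewrite /= ?mulr1 ?mulr0 ?addr0 ?subrr.
by apply: trig_approxD; [exact/trig_approx_istp/is_trig_cst|exact: trig_approxZ].
Qed.

Lemma trig_approx_indicI (A B : set T) : trig_approx (fun x => cindic A x) ->
  trig_approx (fun x => cindic B x) -> trig_approx (fun x => cindic (A `&` B) x).
Proof.
move=> hA hB.
have -> : (fun x => cindic (A `&` B) x) = (fun x => cindic A x * cindic B x).
  by apply/funext => x; rewrite /cindic indicI /= rmorphM.
apply: (@trig_approxM _ _ 1) => // x; rewrite /cindic sq_real indicE.
by case: (_ \in _); rewrite ?expr1n ?expr0n.
Qed.

Lemma trig_approx_indicU (A B : set T) : trig_approx (fun x => cindic A x) ->
  trig_approx (fun x => cindic B x) -> trig_approx (fun x => cindic (A `|` B) x).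
Proof.
move=> hA hB; rewrite -[A `|` B]setCK setCU.
by apply: trig_approx_indicC; apply: trig_approx_indicI; exact: trig_approx_indicC.
Qed.

Lemma trig_approx_indic_bigcup (F : (set T)^nat) : (forall n, measurable (F n)) ->
  (forall n, trig_approx (fun x => cindic (F n) x)) ->
  trig_approx (fun x => cindic (\bigcup_k F k) x).
Proof.
move=> mF hF; set A := \bigcup_k F k.
pose P n := \big[setU/set0]_(k < n) F k.
have PA n : P n `<=` A.
  by rewrite /P -bigcup_mkord; apply: bigcup_subset.
have hP n : trig_approx (fun x => cindic (P n) x).
  elim: n => [|n IH]; last by rewrite /P big_ord_recr; exact: trig_approx_indicU.
  rewrite /P big_ord0; under eq_fun do rewrite /cindic indic0.
  exact: (trig_approx_istp (is_trig_cst 0)).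
apply: (@trig_approx_cvg _ (fun n x => cindic (P n) x) (fun=> 1)) => //.
- by apply: L2_indic; exact: bigcupT_measurable.
- exact: rint_cst.
- move=> n x; rewrite /cindic -rmorphB sq_real !indicE.
  by case: (_ \in _); case: (_ \in _); rewrite ?subrr ?subr0 ?sub0r ?sqrrN ?expr1n ?expr0n.
- move=> x; apply: cvg_near_cst.
  have [[k _ Fk]|xA] := pselect (A x).
    near=> n; rewrite /cindic -rmorphB sq_real !indicE !mem_set ?subrr ?expr0n //.
      rewrite /P -bigcup_mkord; exists k => //=; near: n; exact: nbhs_infty_gt.
    by exists k.
  apply: nearW => n; rewrite /cindic -rmorphB sq_real !indicE !memNset ?subrr ?expr0n //.
  by move/PA.
Unshelve. all: by end_near.
Qed.

(** The target and its generator are left general so that one induction serves twice: for rays under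
    a real coordinate, then for rectangles under [coords]. *)
Lemma trig_approx_dynkin d (X : measurableType d) (u : T -> X) (G : set (set X)) :
  measurable_fun setT u -> @measurable _ X = <<s G >> -> setI_closed G ->
  (forall A, G A -> trig_approx (fun x => cindic (u @^-1` A) x)) ->
  forall A, measurable A -> trig_approx (fun x => cindic (u @^-1` A) x).
Proof.
move=> mu GE GI hG A; rewrite GE.
move: A; apply: (dynkin_induction GE GI) => //.
- rewrite preimage_setT; under eq_fun do rewrite /cindic indicT /=.
  exact: (trig_approx_istp (is_trig_cst 1)).
- by move=> S mS hS; rewrite preimage_setC; exact: trig_approx_indicC.
- move=> F mF _ hF; rewrite preimage_bigcup; apply: trig_approx_indic_bigcup => // n.
  by rewrite -[X in measurable X]setTI; exact: mu.
Qed.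

Lemma trig_approx_indic_coord (u : T -> R) : is_trig (fun x => (u x)%:C) ->
  measurable_fun setT u -> (forall x, `|u x| <= 1) ->
  forall A, measurable A -> trig_approx (fun x => cindic (u @^-1` A) x).
Proof.
move=> hu mu u1.
apply: (@trig_approx_dynkin _ _ u (@RGenInftyO.G R) mu (RGenInftyO.measurableE R)).
- move=> _ _ [a ->] [b ->]; exists (Num.min a b).
  apply/seteqP; split => x /=; rewrite !in_itv /= lt_min; first by move=> [-> ->].
  by move/andP.
- by move=> _ [a ->]; exact: trig_approx_ray.
Qed.

(** Measurable sets of the circle are preimages of plane Borel sets; the preimage of a rectangle is
    an intersection of two coordinate preimages. *)
Lemma trig_approx_indic (A : set T) : measurable A -> trig_approx (fun x => cindic A x).
Proof.
have u1 (a b : R) : a ^+ 2 + b ^+ 2 = 1 -> `|a| <= 1.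
  move=> h; rewrite -[leRHS]normr1 -ler_sqr ?nnegrE // !real_normK ?num_real //.
  by rewrite expr1n -h lerDl sqr_ge0.
move=> [B mB <-]; rewrite setTI.
move: B mB; apply: (trig_approx_dynkin (@measurable_coords R)
  (@measurable_prod_measurableType _ _ _ _)).
- move=> _ _ [A1 mA1 [B1 mB1 <-]] [A2 mA2 [B2 mB2 <-]].
  exists (A1 `&` A2); first exact: measurableI.
  by exists (B1 `&` B2); [exact: measurableI|rewrite setXI].
- move=> _ [A1 mA1 [B1 mB1 <-]].
  have -> : @coords R @^-1` (A1 `*` B1) =
    (fun x : T => complex.Re (x : C)) @^-1` A1 `&`
    (fun x : T => complex.Im (x : C)) @^-1` B1 by [].
  apply: trig_approx_indicI.
  + apply: trig_approx_indic_coord => //; [exact: is_trig_Re|exact: (cmeasurable_z R).1|].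
    by move=> x; apply: (u1 _ (complex.Im (x : C))); exact: sq_circle.
  + apply: trig_approx_indic_coord => //; [exact: is_trig_Im|exact: (cmeasurable_z R).2|].
    by move=> x; apply: (u1 _ (complex.Re (x : C))); rewrite addrC; exact: sq_circle.
Qed.

Import HBNNSimple.

Lemma trig_approx_sum (I : Type) (s : seq I) (F : I -> T -> C) :
  (forall i, trig_approx (F i)) -> trig_approx (fun x => \sum_(i <- s) F i x).
Proof.
move=> hF; elim: s => [|i s IH].
  by under eq_fun do rewrite big_nil; exact: (trig_approx_istp (is_trig_cst 0)).
by under eq_fun do rewrite big_cons; exact: trig_approxD.
Qed.

Lemma trig_approx_simple (h : {nnsfun T >-> R}) : trig_approx (fun x => (h x)%:C).
Proof.
have -> : (fun x => (h x)%:C) = (fun x =>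
  \sum_(y <- finmap.enum_fset (fset_set (range h))) y%:C * cindic (h @^-1` [set y]) x).
  apply/funext => x; rewrite fimfunE fsbig_finite //= rmorph_sum /=.
  by apply: eq_bigr => y _; rewrite rmorphM.
by apply: trig_approx_sum => y; apply: trig_approxZ; exact: trig_approx_indic.
Qed.

(** Simple functions increase to [h], and [h^2] dominates the squared errors. *)
Lemma trig_approx_nneg (h : T -> R) : (forall x, 0 <= h x) ->
  L2 (fun x => (h x)%:C) -> trig_approx (fun x => (h x)%:C).
Proof.
move=> h0 hh.
have mh : measurable_fun setT (EFin \o h) by apply/measurable_EFinP; exact: hh.1.1.
pose h_ := nnsfun_approx measurableT mh.
have cvg_h x : h_ n x @[n --> \oo] --> h x.
  have := cvg_nnsfun_approx measurableT mh (fun x _ => (_ : 0 <= (EFin \o h) x)%E).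
  move=> /(_ (fun x => ltac:(by rewrite lee_fin)) x Logic.I).
  by move/fine_cvgP => [].
have h_le n x : h_ n x <= h x.
  have nd : nondecreasing_seq (fun n => h_ n x).
    by move=> a b ab; exact/lefP/nd_nnsfun_approx.
  have := nondecreasing_cvgn_le nd (cvgP _ (cvg_h x)) n.
  by have -> := cvg_lim (@Rhausdorff R) (cvg_h x).
apply: (@trig_approx_cvg _ (fun n x => (h_ n x)%:C) (fun x => sq (h x)%:C)) => //.
- by move=> n; exact: trig_approx_simple.
- exact: hh.2.
- move=> n x; rewrite -rmorphB !sq_real ler_sqr ?nnegrE ?subr_ge0 //.
  by rewrite gerBl.
- by move=> x; apply: cvg_sq_dist (cvg_h x) => n; rewrite -rmorphB sq_real.
Qed.

Lemma trig_approx_real (h : T -> R) : L2 (fun x => (h x)%:C) ->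
  trig_approx (fun x => (h x)%:C).
Proof.
move=> hh; have mh : measurable_fun setT h by exact: hh.1.1.
(* The values 1 and -1 of [a] give the positive and the negative part of [h]. *)
have H (a : R) : a ^+ 2 = 1 -> trig_approx (fun x => (2^-1 * (`|h x| + a * h x))%:C).
  move=> a1; have a2 x : `|a * h x| = `|h x|.
    by rewrite normrM (_ : `|a| = 1) ?mul1r // -[LHS]sqrtr_sqr a1 sqrtr1.
  apply: trig_approx_nneg => [x|].
    rewrite mulr_ge0 //.
    by have := ler_norm (- (a * h x)); rewrite normrN a2; lra.
  have mn : measurable_fun setT (fun x => 2^-1 * (`|h x| + a * h x)).
    apply: measurable_funM => //; apply: measurable_funD; first exact: measurableT_comp.
    by apply: measurable_funM.
  split; first exact: cmeasurable_real.
  apply: (rint_le _ _ hh.2); first by apply: measurable_sq; exact: cmeasurable_real.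
  move=> x; rewrite ger0_norm ?sq_ge0 // !sq_real.
  have := ler_normD `|h x| (a * h x); rewrite a2 normr_id => h1.
  rewrite -[leRHS](real_normK (num_real _)) -[leLHS](real_normK (num_real _)).
  by rewrite ler_sqr ?nnegrE // normrM ger0_norm //; lra.
have -> : (fun x => (h x)%:C) = (fun x => (2^-1 * (`|h x| + 1 * h x))%:C
    + (-1) * (2^-1 * (`|h x| + (-1) * h x))%:C).
  by apply/funext => x; apply: complex_ext; rewrite !ReImE /=; field.
by apply: trig_approxD; [|apply: trig_approxZ]; apply: H; rewrite ?sqrrN expr1n.
Qed.

Theorem trig_dense f : L2 f -> trig_approx f.
Proof.
move=> hf.
have -> : f = (fun x => (complex.Re (f x))%:C + 'i%C * (complex.Im (f x))%:C).
  by apply/funext => x; exact: complexE.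
have [[f1 f2] _] := hf.
apply: trig_approxD; [|apply: trig_approxZ]; apply: trig_approx_real; split;
  try exact: cmeasurable_real.
- apply: (rint_le _ _ hf.2) => [|x].
    by apply: measurable_sq; exact: cmeasurable_real.
  by rewrite ger0_norm ?sq_ge0 // sq_real Re2_le.
- apply: (rint_le _ _ hf.2) => [|x].
    by apply: measurable_sq; exact: cmeasurable_real.
  by rewrite ger0_norm ?sq_ge0 // sq_real Im2_le.
Qed.

End TrigonometricDensity.

(** * Hardy classes *)

Section HardySpaces.
Variable R : realType.
Local Notation C := R[i].
Local Notation T := (circle R).
Local Notation m := (@circle_measure R).
Implicit Types f g : T -> C.

Lemma rLnorm_powR (r : R) (u : T -> R) : r != 0 -> (forall x, 0 <= u x) ->
  rint (fun x => u x `^ r) ->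
  rLnorm r%:E u = ((\int[m]_x u x `^ r) `^ r^-1)%:E.
Proof.
move=> r0 u0 hu; rewrite /rLnorm unlock /=.
under eq_integral do rewrite ger0_norm //.
by rewrite rint_EFin.
Qed.

Lemma rLnorm_rint (r : R) (u : T -> R) : 0 < r -> (forall x, 0 <= u x) ->
  measurable_fun setT u -> (rLnorm r%:E u < +oo)%E -> rint (fun x => u x `^ r).
Proof.
move=> r0 u0 mu h; apply: rint_lty.
- exact: measurableT_comp (measurable_powR r) mu.
- by move=> x; exact: powR_ge0.
have E : (\int[m]_x (u x `^ r)%:E = rLnorm r%:E u `^ r)%E.
  rewrite /rLnorm poweR_Lnorm ?gt_eqF //; apply: eq_integral => x _.
  by rewrite /= ger0_norm.
by rewrite E; apply: poweR_lty.
Qed.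

Lemma rLnorm_oo (u : T -> R) : (rLnorm +oo%E u < +oo)%E ->
  {ae m, forall x, ((`|u x|)%:E <= rLnorm +oo%E u)%E}.
Proof.
rewrite /rLnorm unlock /= probability_setT lte01 => h.
by apply: filterS (ess_sup_ge m (abse \o (EFin \o u))) => x.
Qed.

(** The class [Hardy 2], phrased with [sq] so that the [L2] lemmas apply directly. *)
Definition H2 f : Prop := L2 f /\ forall n : int, n < 0 -> fourier_coef f n = 0.

Lemma powR2 (x : R) : 0 <= x -> x `^ 2 = x ^+ 2.
Proof. by move=> x0; rewrite powR_mulrn. Qed.

Lemma H2_Hardy f : H2 f -> Hardy 2 f.
Proof.
move=> [hf h]; split => //; first exact: hf.1.
have E : (fun x => normc (f x) `^ 2) = (fun x => sq (f x)).
  by apply/funext => x; rewrite powR2 ?normc_ge0 // normcE2.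
have hr : rint (fun x => normc (f x) `^ 2) by rewrite E; exact: hf.2.
by rewrite (rLnorm_powR _ (fun x => normc_ge0 (f x)) hr) ?ltry.
Qed.

Lemma Hardyoo_ess_bounded f : Hardy +oo%E f -> ess_bounded f.
Proof.
move=> [mf hf _]; split => //.
have := rLnorm_oo hf.
have : (0 <= rLnorm +oo%E (fun x => normc (f x)))%E by exact: Lnorm_ge0.
case: (rLnorm _ _) hf => [K _|//|//]; rewrite lee_fin => K0 h.
exists (K ^+ 2); split; first exact: sqr_ge0.
apply: filterS h => x; rewrite lee_fin ger0_norm ?normc_ge0 // -normcE2 => h.
by rewrite ler_sqr ?nnegrE ?normc_ge0.
Qed.

(** On a probability space it suffices that [x^2 <= 1 + x^r] for [x >= 0] and [r >= 2]. *)
Lemma Hardy_H2 (q : \bar R) f : (2 <= q)%E -> Hardy q f -> H2 f.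
Proof.
case: q => [r|_|//]; last first.
  by move=> hf; split; [exact/ess_bounded_L2/Hardyoo_ess_bounded|case: hf].
rewrite lee_fin => r2 [mf hf h]; split => //; split => //.
have r0 : 0 < r by exact: lt_le_trans r2.
have := rLnorm_rint r0 (fun x => normc_ge0 (f x)) (measurable_normc mf) hf.
move=> /(rintD (rint_cst 1)); apply: rint_le; first exact: measurable_sq.
move=> x; rewrite ger0_norm ?sq_ge0 // -normcE2.
have [h1|h1] := leP (normc (f x)) 1.
  by rewrite (@le_trans _ _ 1) ?exprn_ile1 ?normc_ge0 // lerDl powR_ge0.
rewrite -powR2 ?normc_ge0 // (@le_trans _ _ (normc (f x) `^ r)) //.
  by rewrite ler_powR // ltW.
by rewrite lerDr.
Qed.

Lemma cintegrable_coef f (n : int) : L2 f -> cintegrable (fun x => f x * (x : C) ^ n).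
Proof.
by move=> hf; apply: (L2_cintegrableM hf); exact/ess_bounded_L2/ess_bounded_zexp.
Qed.

Lemma H2D f g : H2 f -> H2 g -> H2 (fun x => f x + g x).
Proof.
move=> [hf f0] [hg g0]; split; first exact: L2D.
move=> n n0; rewrite /fourier_coef; under eq_fun do rewrite mulrDl.
rewrite cintegralD; try exact: cintegrable_coef.
by rewrite -!/(fourier_coef _ _) f0 ?g0 ?addr0.
Qed.

Lemma H2Z (c : C) f : H2 f -> H2 (fun x => c * f x).
Proof.
move=> [hf f0]; split; first exact: L2Z.
move=> n n0; rewrite /fourier_coef; under eq_fun do rewrite -mulrA.
rewrite cintegralZ; last exact: cintegrable_coef.
by rewrite -/(fourier_coef _ _) f0 ?mulr0.
Qed.

Lemma H2_cst (c : C) : H2 (fun=> c).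
Proof.
split; first exact: L2_cst.
move=> n n0; rewrite /fourier_coef cintegralZ; last first.
  exact/L2_cintegrable/ess_bounded_L2/ess_bounded_zexp.
by rewrite cintegral_zexp ?mulr0 // oppr_eq0 lt_eqF.
Qed.

Lemma H2_sum (I : Type) (s : seq I) (F : I -> T -> C) :
  (forall i, H2 (F i)) -> H2 (fun x => \sum_(i <- s) F i x).
Proof.
move=> hF; elim: s => [|i s IH].
  by under eq_fun do rewrite big_nil; exact: H2_cst.
by under eq_fun do rewrite big_cons; exact: H2D.
Qed.

(** Multiplication by [conj z] lowers every index by one; only the mean could land on a negative
    index, and it vanishes. *)
Lemma H2_shift f : H2 f -> cintegral f = 0 -> H2 (fun x => (x : C)^*%C * f x).
Proof.
move=> [hf f0] fi; split.
  by apply: ess_boundedM_L2 => //; apply: ess_boundedJ; exact: ess_bounded_z.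
move=> n n0; rewrite /fourier_coef.
have -> : (fun x : T => (x : C)^*%C * f x * (x : C) ^ (- n)) =
    (fun x : T => f x * (x : C) ^ (- (n + 1))).
  apply/funext => x; rewrite circle_conjV opprD expfzDr ?circle_unit // exprN1.
  by rewrite -mulrA mulrCA; congr (_ * _); exact: mulrC.
have [->|n1] := eqVneq n (-1).
  by rewrite addNr oppr0; under eq_fun do rewrite expr0z mulr1.
apply: f0; rewrite lt_neqAle lezD1 n0 andbT.
by apply: contraNneq n1 => /eqP; rewrite addr_eq0.
Qed.

Lemma trig_filter (p : pred (int * C)) (s : seq (int * C)) x :
  trig s x = trig (seq.filter p s) x + trig (seq.filter (predC p) s) x.
Proof. by rewrite /trig !big_filter (bigID p). Qed.

Lemma cintegral_trigM (s : seq (int * C)) g : L2 g ->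
  cintegral (fun x => trig s x * g x) = \sum_(a <- s) a.2 * fourier_coef g (- a.1).
Proof.
move=> hg; rewrite /trig; under eq_fun do rewrite mulr_suml.
rewrite cintegral_sum; last first.
  move=> a; under eq_fun do rewrite -mulrA; apply: cintegrableZ.
  by under eq_fun do rewrite mulrC; exact: cintegrable_coef.
apply: eq_bigr => a _; under eq_fun do rewrite -mulrA.
under eq_fun do rewrite [_ ^ _ * _]mulrC.
by rewrite cintegralZ; [rewrite /fourier_coef opprK|exact: cintegrable_coef].
Qed.

Lemma fourier_coef_trig (s : seq (int * C)) (n : int) :
  (forall a, a \in s -> a.1 != n) -> fourier_coef (trig s) n = 0.
Proof.
move=> hs; rewrite /fourier_coef cintegral_trigM; last exact/ess_bounded_L2/ess_bounded_zexp.
rewrite big_seq big1 // => a /hs an.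
rewrite /fourier_coef opprK (_ : (fun _ => _) = fun x : T => (x : C) ^ (a.1 - n)).
  by rewrite cintegral_zexp ?mulr0 // subr_eq0.
by apply/funext => x; rewrite mulrC -expfzDr // circle_unit.
Qed.

(* The analytic part of an approximating trigonometric polynomial is a better
   approximation, the error being orthogonal to the other part. *)
Lemma H2_trig_approx f (e : R) : H2 f -> 0 < e -> exists s : seq (int * C),
  (forall a, a \in s -> 0 <= a.1) /\ \int[m]_x sq (f x - trig s x) <= e.
Proof.
move=> [hf f0] e0; have [_ /(_ e e0)[s hs]] := trig_dense hf.
pose p := [pred a : int * C | 0 <= a.1].
pose s1 := seq.filter p s; pose s2 := seq.filter (predC p) s.
have s1p a : a \in s1 -> 0 <= a.1 by rewrite mem_filter => /andP[].
have s2p a : a \in s2 -> a.1 < 0 by rewrite mem_filter => /andP[/=]; rewrite -ltNge.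
exists s1; split => //; apply: le_trans hs.
have L1 := ess_bounded_L2 (trig_essb s1); have L2' := ess_bounded_L2 (trig_essb s2).
have LD := L2B hf L1.
(* All exponents in [s2] are negative, and neither [f] nor [trig s1] has a nonzero coefficient of
   negative index. *)
have orth : cintegral (fun x => (f x - trig s1 x) * (trig s2 x)^*%C) = 0.
  under eq_fun do rewrite -[_ * _]conjcK rmorphM /= conjcK [_ * trig _ _]mulrC.
  rewrite cintegralJ; last by apply: L2_cintegrableM => //; exact: L2J.
  rewrite cintegral_trigM; last exact: L2J.
  rewrite big_seq big1 ?conjc0 // => a /s2p a0.
  rewrite /fourier_coef opprK.
  have E : (fun x : T => (f x - trig s1 x)^* * (x : C) ^ a.1) =
      (fun x : T => (f x * (x : C) ^ (- a.1) - trig s1 x * (x : C) ^ (- a.1))^*).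
    by apply/funext => x; rewrite -mulrBl rmorphM /= circle_conj_exp opprK.
  rewrite E cintegralJ; last first.
    by under eq_fun do rewrite -mulrBl; exact: cintegrable_coef.
  rewrite cintegralB; try exact: cintegrable_coef.
  rewrite -!/(fourier_coef _ _) f0 // fourier_coef_trig ?subrr ?conjc0 ?mulr0 //.
  by move=> b /s1p b0; rewrite gt_eqF // (lt_le_trans a0).
have [c1 c2] := L2_cintegrableM LD (L2J L2').
have -> : \int[m]_x sq (f x - trig s x) = \int[m]_x (sq (f x - trig s1 x) + sq (trig s2 x)).
  transitivity (\int[m]_x ((sq (f x - trig s1 x) + sq (trig s2 x)) -
      2 * complex.Re ((f x - trig s1 x) * (trig s2 x)^*%C))).
    apply: eq_Rintegral => x _; rewrite (trig_filter p s x) -/s1 -/s2 /sq !ReImE; ring.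
  rewrite intB; [|by apply: rintD; exact: L2_sq|exact: rintZ].
  by rewrite intZ // -Re_cintegral orth mulr0 subr0.
apply: int_le; [exact: L2_sq|by apply: rintD; exact: L2_sq|].
by move=> x; rewrite lerDl sq_ge0.
Qed.

(** For fixed [n < 0], pairing with [G = g z^-n] kills every analytic trigonometric polynomial, is
    continuous in L^2, and hence kills all of H^2. *)
Lemma H2_prod_coef f g : H2 f -> H2 g ->
  forall n : int, n < 0 -> fourier_coef (fun x => f x * g x) n = 0.
Proof.
move=> hf hg n n0; set I := fourier_coef _ n.
pose G x := g x * (x : C) ^ (- n).
have LG : L2 G.
  rewrite /G; under eq_fun do rewrite mulrC.
  by apply: ess_boundedM_L2; [exact: ess_bounded_zexp|exact: hg.1].
have key h : H2 h -> complex.Re (cintegral (fun x => h x * G x)) <= 0.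
  move=> hh; apply/ler_addgt0Pl => d d0; rewrite addr0.
  set B := \int[m]_x sq (G x).
  have B0 : 0 <= B by apply: int_ge0 => x; exact: sq_ge0.
  (* With approximation error [d / t], both terms of the weighted inequality are at most [d]; the 1
     covers [B = 0]. *)
  have t0 : 0 < (B + 1) / d by rewrite divr_gt0 // ltr_pwDr.
  have [s [sp hs]] := H2_trig_approx hh (divr_gt0 d0 t0).
  have Ls := ess_bounded_L2 (trig_essb s); have LD := L2B hh.1 Ls.
  have -> : cintegral (fun x => h x * G x) = cintegral (fun x => (h x - trig s x) * G x).
    under [in RHS]eq_fun do rewrite mulrBl.
    rewrite cintegralB; [|exact: L2_cintegrableM hh.1 LG|exact: L2_cintegrableM Ls LG].
    rewrite cintegral_trigM // big_seq big1 ?subr0 // => a /sp a0.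
    rewrite /fourier_coef opprK /G.
    have -> : (fun x : T => g x * (x : C) ^ (- n) * (x : C) ^ a.1) =
        (fun x : T => g x * (x : C) ^ (- (n - a.1))).
      by apply/funext => x; rewrite -mulrA -expfzDr ?circle_unit // opprB addrC.
    rewrite -/(fourier_coef _ _) hg.2 ?mulr0 // subr_lt0.
    exact: lt_le_trans a0.
  have := Re_cintegralM_le LD LG t0; rewrite -/B invf_div => h1.
  have h2 : (B + 1) / d * (\int[m]_x sq (h x - trig s x)) <= d.
    by rewrite mulrC -ler_pdivlMr.
  have h3 : d / (B + 1) * B <= d.
    by rewrite mulrAC ler_pdivrMr ?ltr_pwDr // ler_wpM2l ?(ltW d0) // lerDl.
  lra.
(* A one-sided bound on real parts is enough: applied to [conj I * f] it says [|I|^2 <= 0]. *)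
apply: sq_eq0; apply/eqP; rewrite eq_le sq_ge0 andbT.
have := key _ (H2Z (conjc I) hf); under eq_fun do rewrite -mulrA.
rewrite cintegralZ; last exact: L2_cintegrableM hf.1 LG.
have -> : cintegral (fun x => f x * G x) = I.
  by rewrite /I /fourier_coef; congr cintegral; apply/funext => x; rewrite /G mulrA.
by rewrite conj_mul.
Qed.

Lemma HardyooM f g : Hardy +oo%E f -> H2 g -> H2 (fun x => f x * g x).
Proof.
move=> hf hg; split.
  by apply: ess_boundedM_L2; [exact: Hardyoo_ess_bounded|exact: hg.1].
by apply: H2_prod_coef => //; exact: (Hardy_H2 (leey _) hf).
Qed.

Definition mxH2 k l (F : T -> 'M[C]_(k, l)) : Prop :=
  forall i j, H2 (fun x => F x i j).

Lemma mx_HardyooM k l n (F : T -> 'M[C]_(k, l)) (G : T -> 'M[C]_(l, n)) :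
  mx_Hardy +oo%E F -> mxH2 G -> mxH2 (fun x => F x *m G x).
Proof.
move=> hF hG i j; under eq_fun do rewrite mxE.
by apply: H2_sum => a; exact: HardyooM.
Qed.

End HardySpaces.

(** * Operator norm and polar factorizations of 2 x 2 matrices *)

Section PlaneMatrices.
Variable R : realType.
Local Notation C := R[i].
Implicit Types (x y : 'cV[C]_2) (M N P Q X : 'M[C]_2).

(** Convertible with the [^t*] of the statement, so its hypotheses fit the lemmas about [adj] as
    they stand. *)
Definition adj k l (M : 'M[C]_(k, l)) : 'M[C]_(l, k) := map_mx Num.conj M^T.

Lemma adjE k l (M : 'M[C]_(k, l)) i j : adj M i j = (M j i)^*.
Proof. by rewrite !mxE. Qed.

Lemma adjM k l n (M : 'M[C]_(k, l)) (N : 'M[C]_(l, n)) :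
  adj (M *m N) = adj N *m adj M.
Proof. by rewrite /adj trmx_mul map_mxM. Qed.

Lemma adjK k l (M : 'M[C]_(k, l)) : adj (adj M) = M.
Proof. by apply/matrixP => i j; rewrite !adjE conjcK. Qed.

Lemma adjZ k l (c : C) (M : 'M[C]_(k, l)) : adj (c *: M) = c^*%C *: adj M.
Proof. by apply/matrixP => i j; rewrite !(mxE, adjE) rmorphM. Qed.

Lemma adj_unitmx M : (adj M \in unitmx) = (M \in unitmx).
Proof. by rewrite /adj map_unitmx unitmx_tr. Qed.

Lemma adj_invmx M : adj (invmx M) = invmx (adj M).
Proof. by rewrite /adj trmx_inv map_invmx. Qed.

Definition vsq x : R := \sum_i sq (x i 0).

Lemma vsq_ge0 x : 0 <= vsq x.
Proof. by apply: sumr_ge0 => i _; exact: sq_ge0. Qed.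

Lemma vsq_adj x : (adj x *m x) 0 0 = (vsq x)%:C.
Proof.
by rewrite mxE /vsq rmorph_sum; apply: eq_bigr => i _; rewrite adjE; exact: conj_mul.
Qed.

Lemma vsqE x : vsq x = sq (x 0 0) + sq (x 1 0).
Proof.
rewrite /vsq !big_ord_recl big_ord0 addr0.
by congr (sq (x _ 0) + sq (x _ 0)); exact/val_inj.
Qed.

Lemma vsq_isometry M x : adj M *m M = 1%:M -> vsq (M *m x) = vsq x.
Proof.
move=> h; suff: (vsq (M *m x))%:C = (vsq x)%:C by case.
by rewrite -!vsq_adj adjM mulmxA -(mulmxA (adj x)) h mulmx1.
Qed.

Lemma vsqZ (c : C) x : vsq (c *: x) = sq c * vsq x.
Proof. by rewrite /vsq mulr_sumr; apply: eq_bigr => i _; rewrite mxE sqM. Qed.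

Lemma eucl_norm_ge0 x : 0 <= eucl_norm x.
Proof. exact: sqrtr_ge0. Qed.

Lemma eucl_norm2 x : eucl_norm x ^+ 2 = vsq x.
Proof.
rewrite /eucl_norm sqr_sqrtr; first by apply: eq_bigr => i _; rewrite normcE2.
by apply: sumr_ge0 => i _; exact: sqr_ge0.
Qed.

Lemma eucl_normE x : eucl_norm x = Num.sqrt (vsq x).
Proof. by rewrite -eucl_norm2 sqrtr_sqr ger0_norm // eucl_norm_ge0. Qed.

Lemma eucl_norm_le x (a : R) : 0 <= a -> (eucl_norm x <= a) = (vsq x <= a ^+ 2).
Proof. by move=> a0; rewrite -eucl_norm2 ler_sqr ?nnegrE ?eucl_norm_ge0. Qed.

(* The Gram matrix of the columns of M is [[gram1 M, gram12 M], [., gram2 M]]. *)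
Definition gram1 M : R := sq (M 0 0) + sq (M 1 0).
Definition gram2 M : R := sq (M 0 1) + sq (M 1 1).
Definition gram12 M : C := (M 0 0)^*%C * M 0 1 + (M 1 0)^*%C * M 1 1.

Lemma mulmx2E M x (i : 'I_2) : (M *m x) i 0 = M i 0 * x 0 0 + M i 1 * x 1 0.
Proof.
rewrite mxE !big_ord_recl big_ord0 addr0.
by congr (M i _ * x _ 0 + M i _ * x _ 0); exact/val_inj.
Qed.

Lemma vsq_mulmx M x : vsq (M *m x) = gram1 M * sq (x 0 0) + gram2 M * sq (x 1 0)
  + 2 * complex.Re ((x 0 0)^*%C * gram12 M * x 1 0).
Proof.
rewrite vsqE !mulmx2E /gram1 /gram2 /gram12 /sq !ReImE; ring.
Qed.

(** The determinant criterion for the Hermitian form [s1 |a|^2 - 2 Re (conj a n b) + s2 |b|^2] to be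
    nonnegative. *)
Lemma psd2P (s1 s2 : R) (n : C) :
  (forall a b : C, 2 * complex.Re (a^*%C * n * b) <= s1 * sq a + s2 * sq b) <->
  [/\ 0 <= s1, 0 <= s2 & sq n <= s1 * s2].
Proof.
split=> [H|[s10 s20 ns] a b].
  have h1 : 0 <= s1.
    by have := H 1 0; rewrite mulr0 sq1 sq0 mulr1 !mulr0 addr0.
  have h2 : 0 <= s2.
    by have := H 0 1; rewrite sq1 sq0 conjc0 !mul0r /= !mulr0 mulr1 add0r.
  split => //.
  move: h1; rewrite le_eqVlt => /predU1P[s10|s1p].
    rewrite -s10 mul0r leNgt; apply/negP => n0.
    (* If [s1 = 0] and [n] is nonzero, the vector [(t n, 1)] would give [s2 + 1 <= s2]. *)
    pose t := (s2 + 1) / (2 * sq n).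
    have tn : t * sq n = (s2 + 1) / 2 by rewrite /t; field; rewrite gt_eqF.
    have := H (t%:C * n) 1; rewrite -s10 mul0r add0r sq1.
    have -> : complex.Re ((t%:C * n)^*%C * n * 1) = t * sq n.
      by rewrite /sq !ReImE /=; ring.
    by rewrite tn mulr1; lra.
  (* The vector [(n, s1)] makes the form equal to [s1] times the determinant. *)
  have := H n s1%:C; rewrite sq_real.
  have -> : complex.Re (n^*%C * n * s1%:C) = s1 * sq n.
    by rewrite /sq !ReImE /=; ring.
  by move=> h; rewrite -(ler_pM2l s1p); lra.
move: s10; rewrite le_eqVlt => /predU1P[s10|s1p].
  have n0 : n = 0.
    by apply: sq_eq0; apply/eqP; rewrite eq_le sq_ge0 andbT; rewrite -s10 mul0r in ns.
  by rewrite n0 mulr0 mul0r mulr0 -s10 mul0r add0r mulr_ge0 ?sq_ge0.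
rewrite -subr_ge0 -(pmulr_rge0 _ s1p).
have -> : s1 * (s1 * sq a + s2 * sq b - 2 * complex.Re (a^*%C * n * b)) =
    sq (s1%:C * a - n * b) + (s1 * s2 - sq n) * sq b.
  by rewrite /sq !ReImE /=; ring.
by rewrite addr_ge0 ?mulr_ge0 ?sq_ge0 ?subr_ge0.
Qed.

Lemma contractionP M (a : R) :
  (forall x, vsq (M *m x) <= a ^+ 2 * vsq x) <->
  [/\ gram1 M <= a ^+ 2, gram2 M <= a ^+ 2 &
      sq (gram12 M) <= (a ^+ 2 - gram1 M) * (a ^+ 2 - gram2 M)].
Proof.
have E x : (vsq (M *m x) <= a ^+ 2 * vsq x) =
    (2 * complex.Re ((x 0 0)^*%C * gram12 M * x 1 0) <=
     (a ^+ 2 - gram1 M) * sq (x 0 0) + (a ^+ 2 - gram2 M) * sq (x 1 0)).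
  by rewrite vsq_mulmx vsqE -subr_ge0 -[RHS]subr_ge0; congr (0 <= _); ring.
rewrite -(subr_ge0 (gram1 M)) -(subr_ge0 (gram2 M)).
split=> [H|/psd2P H x]; last by rewrite E.
apply/psd2P => u v.
have := H (\col_i (if i == 0 then u else v)).
by rewrite E !mxE /=.
Qed.

(** The larger eigenvalue of [M^* M]. [op_norm] is a supremum over an uncountable set; this closed
    formula for its square makes it measurable along a matrix function. *)
Definition opsq M : R := (gram1 M + gram2 M +
  Num.sqrt ((gram1 M - gram2 M) ^+ 2 + 4 * sq (gram12 M))) / 2.

Lemma opsqP M (a : R) :
  (forall x, vsq (M *m x) <= a ^+ 2 * vsq x) <-> opsq M <= a ^+ 2.
Proof.
rewrite contractionP /opsq.
set g1 := gram1 M; set g2 := gram2 M; set n := sq (gram12 M).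
have n0 : 0 <= n by exact: sq_ge0.
set d := (g1 - g2) ^+ 2 + 4 * n; set D := Num.sqrt d.
have d0 : 0 <= d by rewrite addr_ge0 ?sqr_ge0 // mulr_ge0.
have D0 : 0 <= D by exact: sqrtr_ge0.
have D2 : D ^+ 2 = d by rewrite sqr_sqrtr.
split=> [[h1 h2 h3]|h].
  have : D <= 2 * a ^+ 2 - g1 - g2; last by lra.
  rewrite -ler_sqr ?nnegrE //; last by lra.
  by rewrite D2 /d; nra.
have h' : D <= 2 * a ^+ 2 - g1 - g2 by lra.
have h12 : D ^+ 2 <= (2 * a ^+ 2 - g1 - g2) ^+ 2.
  by rewrite ler_sqr ?nnegrE // (le_trans D0).
have gD : `|g1 - g2| <= D.
  by rewrite -[`|_|]sqrtr_sqr /D ler_sqrt // lerDl mulr_ge0.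
move: gD; rewrite ler_norml => /andP[gD1 gD2].
by rewrite D2 /d in h12; split; [lra|lra|nra].
Qed.

Lemma opsq_ge0 M : 0 <= opsq M.
Proof.
have g1 : 0 <= gram1 M by rewrite addr_ge0 ?sq_ge0.
have g2 : 0 <= gram2 M by rewrite addr_ge0 ?sq_ge0.
by rewrite /opsq divr_ge0 // addr_ge0 ?sqrtr_ge0 // addr_ge0.
Qed.

Lemma vsq_mul_opsq M x : vsq (M *m x) <= opsq M * vsq x.
Proof.
have := (opsqP M (Num.sqrt (opsq M))).2; rewrite sqr_sqrtr ?opsq_ge0 //.
by move=> h; apply: h.
Qed.

Lemma op_normE M : op_norm M = Num.sqrt (opsq M).
Proof.
set S := [set eucl_norm (M *m x) | x in [set x | eucl_norm x <= 1]].
have ubS : ubound S (Num.sqrt (opsq M)).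
  move=> _ [x /= x1 <-]; rewrite eucl_norm_le ?sqrtr_ge0 // sqr_sqrtr ?opsq_ge0 //.
  rewrite (le_trans (vsq_mul_opsq M x)) // ler_piMr ?opsq_ge0 //.
  by move: x1; rewrite eucl_norm_le // expr1n.
have S0 : S (eucl_norm (M *m 0)).
  by exists 0 => //=; rewrite eucl_norm_le // /vsq big1 // => i _; rewrite mxE sq0.
have hS : has_sup S by split; [exists (eucl_norm (M *m 0))|exists (Num.sqrt (opsq M))].
have s0 : 0 <= sup S.
  exact: (le_trans (eucl_norm_ge0 _) (sup_upper_bound hS S0)).
apply/eqP; rewrite eq_le; apply/andP; split.
  by apply: ge_sup => //; exists (eucl_norm (M *m 0)).
rewrite -[leRHS]ger0_norm // -sqrtr_sqr ler_sqrt ?sqr_ge0 //.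
apply/opsqP => x.
have [x0|x0] := eqVneq (vsq x) 0.
  have := vsq_mul_opsq M x; rewrite x0 !mulr0 => h.
  exact: h.
have xp : 0 < vsq x by rewrite lt_def x0 vsq_ge0.
pose y := ((Num.sqrt (vsq x))^-1)%:C *: x.
have sy : sq ((Num.sqrt (vsq x))^-1)%:C = (vsq x)^-1.
  by rewrite sq_real exprVn sqr_sqrtr // ltW.
have : S (eucl_norm (M *m y)).
  by exists y => //=; rewrite eucl_norm_le // vsqZ sy mulVf // expr1n.
move=> /(sup_upper_bound hS); rewrite eucl_norm_le //.
by rewrite -scalemxAr vsqZ sy mulrC ler_pdivrMr.
Qed.

Lemma op_norm_ge0 M : 0 <= op_norm M.
Proof. by rewrite op_normE sqrtr_ge0. Qed.

Lemma vsq_mul_op_norm M x : vsq (M *m x) <= op_norm M ^+ 2 * vsq x.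
Proof. by rewrite op_normE sqr_sqrtr ?opsq_ge0 // vsq_mul_opsq. Qed.

Lemma op_norm_isometry M : adj M *m M = 1%:M -> op_norm M = 1.
Proof.
move=> h; apply/eqP; rewrite eq_le; apply/andP; split.
  rewrite op_normE -sqrtr1 ler_sqrt // -[1](expr1n _ 2); apply/opsqP => x.
  by rewrite vsq_isometry // expr1n mul1r.
have := vsq_mul_op_norm M (delta_mx 0 0); rewrite vsq_isometry //.
have -> : vsq (delta_mx 0 0) = 1 by rewrite vsqE !mxE /= sq1 sq0 addr0.
by rewrite mulr1 expr_ge1 // op_norm_ge0.
Qed.

(** The pointwise counterpart of [Re_cintegralM_le], again by completing the square. *)
Lemma Re_adj_mul_le x y (t : R) : 0 < t ->
  2 * complex.Re ((adj x *m y) 0 0) <= t * vsq y + t^-1 * vsq x.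
Proof.
move=> t0; rewrite mxE raddf_sum /= mulr_sumr /vsq !mulr_sumr -big_split.
apply: ler_sum => i _; rewrite adjE /sq !ReImE /=.
set a := complex.Re (y i 0); set b := complex.Im (y i 0).
set c := complex.Re (x i 0); set d := complex.Im (x i 0).
have -> : t * (a ^+ 2 + b ^+ 2) + t^-1 * (c ^+ 2 + d ^+ 2) =
  2 * (c * a - (- d) * b) + t^-1 * ((t * a - c) ^+ 2 + (t * b - d) ^+ 2).
  by field; rewrite gt_eqF.
by rewrite lerDl mulr_ge0 ?invr_ge0 ?(ltW t0) // addr_ge0 ?sqr_ge0.
Qed.

Lemma tr_adj_mul M N : \tr (adj M *m N) = \sum_j (adj (col j M) *m col j N) 0 0.
Proof.
rewrite /mxtrace; apply: eq_bigr => j _; rewrite !mxE; apply: eq_bigr => i _.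
by rewrite !adjE !mxE.
Qed.

(** * Algebra of the factorizations [A = P P^*] and [A^2 = Q Q^*] *)

Section Factorizations.
Variables (P Q A : 'M[C]_2).
Hypotheses (uP : P \in unitmx) (uQ : Q \in unitmx).
Hypothesis AE : A = P *m adj P.
Hypothesis AQ : A *m A = Q *m adj Q.

Lemma adj_A : adj A = A.
Proof. by rewrite AE adjM adjK. Qed.

Lemma unit_A : A \in unitmx.
Proof. by rewrite AE unitmx_mul adj_unitmx uP. Qed.

(** [A] is the positive square root of [Q Q^*], so this is the unitary factor in the polar
    decomposition of [Q]. *)
Lemma A_Q_unitary : (invmx A *m Q) *m adj (invmx A *m Q) = 1%:M.
Proof.
rewrite adjM adj_invmx adj_A mulmxA -(mulmxA _ Q) -AQ mulmxA mulVmx ?unit_A //.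
by rewrite mul1mx mulmxV ?unit_A.
Qed.

(* The trace norm of Q is the trace of |Q*| = A. *)
Lemma Re_tr_le X (w : C) : sq w = 1 -> \tr (adj P *m P) = 1 ->
  complex.Re (w * \tr (Q *m X)) <= op_norm X.
Proof.
move=> w1 trP; pose V := invmx A *m Q.
have VV : adj V *m V = 1%:M by apply: mulmx1C; exact: A_Q_unitary.
have QE : Q = A *m V by rewrite mulmxA mulmxV ?unit_A // mul1mx.
(* [Q = P P^* V] and cyclicity of the trace lead to a sum over the columns of [P], whose squared
   lengths add up to 1. *)
have -> : w * \tr (Q *m X) = \tr (adj P *m (w *: (V *m X *m P))).
  by rewrite -scalemxAr mxtraceZ QE AE -!mulmxA mxtrace_mulC -!mulmxA.
(* The weight below is the inverse of [o + d], with [d > 0] because [o] may vanish. *)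
apply/ler_addgt0Pr => d d0; set o := op_norm X.
have o0 : 0 <= o by exact: op_norm_ge0.
have od : 0 < o + d by rewrite ltr_pwDr.
have tv : \sum_j vsq (col j P) = 1.
  suff: (\sum_j vsq (col j P))%:C = 1 by case.
  by rewrite -trP tr_adj_mul rmorph_sum; apply: eq_bigr => j _; rewrite vsq_adj.
rewrite tr_adj_mul raddf_sum /= -[leRHS]mulr1 -tv mulr_sumr.
apply: ler_sum => j _.
have -> : col j (w *: (V *m X *m P)) = w *: (V *m (X *m col j P)).
  by rewrite !colE -scalemxAl !mulmxA.
have h := Re_adj_mul_le (col j P) (w *: (V *m (X *m col j P))) (_ : 0 < (o + d)^-1).
rewrite invr_gt0 vsqZ w1 mul1r vsq_isometry // invrK in h.
have {h} h := h od; have h2 := vsq_mul_op_norm X (col j P).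
have h3 : (o + d)^-1 * vsq (X *m col j P) <= (o + d) * vsq (col j P).
  rewrite mulrC ler_pdivrMr // (le_trans h2) // [leRHS]mulrAC -expr2 ler_wpM2r ?vsq_ge0 //.
  by rewrite ler_sqr ?nnegrE ?(ltW od) // lerDl ltW.
rewrite -(ler_pM2l (_ : 0 < 2)) //; lra.
Qed.

Lemma mul_A_invmx : adj (invmx Q) *m invmx Q = invmx (A *m A).
Proof.
have u2 : A *m A \in unitmx by rewrite unitmx_mul unit_A.
apply: (can_inj (mulmxK u2)); rewrite mulVmx // AQ.
by rewrite adj_invmx mulmxA mulmxKV // mulVmx // adj_unitmx.
Qed.

Lemma unitary_symbol (w : C) : sq w = 1 ->
  adj (w *: (invmx Q *m A)) *m (w *: (invmx Q *m A)) = 1%:M.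
Proof.
move=> w1; have u2 : A *m A \in unitmx by rewrite unitmx_mul unit_A.
rewrite adjZ -scalemxAl -scalemxAr scalerA conj_mul w1 scale1r adjM adj_A.
rewrite mulmxA -(mulmxA A) mul_A_invmx.
apply: (can_inj (mulKmx unit_A)); rewrite !mulmxA mulmxV // mul1mx mulmx1 //.
Qed.

(** The left side is [k^* P^* A^-2 A f = k^* P^* A^-1 f], and [A^-1 = P^-* P^-1]. Thus pairing [U f]
    with an analytic vector built from [k] becomes pairing the analytic vector [P^-1 f] with [k]. *)
Lemma symbol_duality (w : C) (f k : 'cV[C]_2) : sq w = 1 ->
  adj (w *: (invmx Q *m (P *m k))) *m (w *: (invmx Q *m A) *m f) =
  adj k *m (invmx P *m f).
Proof.
move=> w1; rewrite adjZ -scalemxAl -scalemxAl -scalemxAr scalerA conj_mul w1 scale1r.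
rewrite !adjM -!mulmxA; congr (adj k *m _).
rewrite (mulmxA (adj (invmx Q))) mul_A_invmx.
have u2 : A *m A \in unitmx by rewrite unitmx_mul unit_A.
have -> : invmx (A *m A) *m (A *m f) = invmx A *m f.
  apply: (can_inj (mulKmx u2)); rewrite mulmxA mulmxV // mul1mx.
  by rewrite -!mulmxA (mulmxA A (invmx A)) mulmxV ?unit_A // mul1mx.
apply: (can_inj (mulKmx uP)); rewrite !mulmxA -AE mulmxV ?unit_A // mulmxV //.
Qed.

End Factorizations.

End PlaneMatrices.

(** * Best approximation *)

Section MatrixFunctions.
Variable R : realType.
Local Notation C := R[i].
Local Notation T := (circle R).
Local Notation m := (@circle_measure R).

Lemma mx_measurable_mul k l n (F : T -> 'M[C]_(k, l)) (G : T -> 'M[C]_(l, n)) :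
  mx_measurable F -> mx_measurable G -> mx_measurable (fun x => F x *m G x).
Proof.
move=> hF hG i j; under eq_fun do rewrite mxE.
by apply: cmeasurable_sum => a; exact: cmeasurableM.
Qed.

Lemma mx_measurable_adj k l (F : T -> 'M[C]_(k, l)) :
  mx_measurable F -> mx_measurable (fun x => adj (F x)).
Proof. by move=> hF i j; under eq_fun do rewrite adjE; exact: cmeasurableJ. Qed.

Lemma mx_measurable_scale k l (w : T -> C) (F : T -> 'M[C]_(k, l)) :
  cmeasurable w -> mx_measurable F -> mx_measurable (fun x => w x *: F x).
Proof. by move=> hw hF i j; under eq_fun do rewrite mxE; exact: cmeasurableM. Qed.

Lemma mx_Hardy_measurable k l p (F : T -> 'M[C]_(k, l)) :
  mx_Hardy p F -> mx_measurable F.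
Proof. by move=> hF i j; case: (hF i j). Qed.

Lemma mx_measurableB k l (F G : T -> 'M[C]_(k, l)) :
  mx_measurable F -> mx_measurable G -> mx_measurable (fun x => F x - G x).
Proof. by move=> hF hG i j; under eq_fun do rewrite !mxE; exact: cmeasurableB. Qed.

Lemma measurable_sqrt (u : T -> R) : measurable_fun setT u ->
  measurable_fun setT (fun x => Num.sqrt (u x)).
Proof.
by apply: measurableT_comp; exact: continuous_measurable_fun (@sqrt_continuous R).
Qed.

Lemma measurable_op_norm (F : T -> 'M[C]_2) : mx_measurable F ->
  measurable_fun setT (fun x => op_norm (F x)).
Proof.
move=> hF; under eq_fun do rewrite op_normE /opsq.
have g1 : measurable_fun setT (fun x => gram1 (F x)).
  by apply: measurable_funD; exact: measurable_sq.
have g2 : measurable_fun setT (fun x => gram2 (F x)).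
  by apply: measurable_funD; exact: measurable_sq.
have g12 : measurable_fun setT (fun x => sq (gram12 (F x))).
  by apply/measurable_sq/cmeasurableD; apply: cmeasurableM => //; exact: cmeasurableJ.
apply: measurable_sqrt; apply: measurable_funM; last exact: measurable_cst.
apply: measurable_funD; first exact: measurable_funD.
apply: measurable_sqrt; apply: measurable_funD.
  by apply: measurable_funX; exact: measurable_funB.
by apply: measurable_funM => //; exact: measurable_cst.
Qed.

(** The tangent at 1 of the convex function [x^p]; it is Young's inequality with second factor 1. *)
Lemma powR_ge_tangent (x p : R) : 0 <= x -> 1 < p -> 1 + p * (x - 1) <= x `^ p.
Proof.
move=> x0 p1; have p0 : 0 < p by rewrite (lt_trans _ p1).
have q0 : 0 < p / (p - 1) by rewrite divr_gt0 // subr_gt0.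
have pq : p^-1 + (p / (p - 1))^-1 = 1.
  by rewrite invf_div; field; rewrite gt_eqF.
have := conjugate_powR x0 ler01 p0 q0 pq; rewrite powR1 mulr1 mul1r => h.
rewrite -(ler_pM2l p0) in h; rewrite invf_div in h.
have E : p * (x `^ p / p + (p - 1) / p) = x `^ p + (p - 1) by field; rewrite gt_eqF.
by rewrite E in h; lra.
Qed.

Lemma Hardy0 (p : \bar R) : p != 0%E -> Hardy p (fun=> 0 : C).
Proof.
move=> p0; split; [exact: cmeasurable_cst| |exact: (H2_cst 0).2].
rewrite /rLnorm (_ : (_ \o _) = cst 0%E) ?Lnorm0 ?ltry //.
by apply/funext => x /=; rewrite expr0n /= addr0 sqrtr0.
Qed.

Lemma rLnorm_ae1 (p : R) (u : T -> R) : p != 0 -> measurable_fun setT u ->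
  (forall x, 0 <= u x) -> {ae m, forall x, u x = 1} -> rLnorm p%:E u = 1%E.
Proof.
move=> p0 mu u0 u1.
have mup : measurable_fun setT (fun x => u x `^ p).
  exact: measurableT_comp (measurable_powR p) mu.
have up1 : {ae m, forall x, u x `^ p = 1}.
  by apply: filterS u1 => x ->; rewrite powR1.
rewrite rLnorm_powR //; last first.
  apply: (rint_ae_le mup _ (rint_cst 1)).
  by apply: filterS up1 => x ->; rewrite normr1.
by rewrite (int_ae_eq mup (measurable_cst _) up1) int_cst powR1.
Qed.

End MatrixFunctions.

(** * Bad approximability by duality *)

Section BadApproximation.
Variable R : realType.
Local Notation C := R[i].
Local Notation T := (circle R).
Local Notation m := (@circle_measure R).
Variables (p : R) (Psi Q : T -> 'M[C]_2).
Hypothesis p2 : 2 <= p.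
Hypotheses (hPsi : invertible_Hoo Psi) (hQ : invertible_Hoo Q).
Let A (x : T) : 'M[C]_2 := Psi x *m adj (Psi x).
Hypothesis AQ : {ae m, forall x, A x *m A x = Q x *m adj (Q x)}.
Hypothesis trPsi : {ae m, forall x, \tr (adj (Psi x) *m Psi x) = 1}.
Let U (x : T) : 'M[C]_2 := (x : C)^*%C *: (invmx (Q x) *m A x).

Lemma sq_conj_circle (x : T) : sq ((x : C)^*%C) = 1.
Proof. by rewrite sqJ sq_circle. Qed.

Lemma U_isometry : {ae m, forall x, adj (U x) *m U x = 1%:M}.
Proof.
have [_ uP _] := hPsi; have [_ uQ _] := hQ.
apply: filterS3 uP uQ AQ => x h1 h2 h3.
exact: (unitary_symbol h1 h2 erefl h3 (sq_conj_circle x)).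
Qed.

Lemma U_measurable : mx_measurable U.
Proof.
have [/mx_Hardy_measurable mP _ _] := hPsi.
have [_ _ /mx_Hardy_measurable mQ] := hQ.
apply: mx_measurable_scale; first exact/cmeasurableJ/cmeasurable_z.
apply: mx_measurable_mul => //; apply: mx_measurable_mul => //.
exact: mx_measurable_adj.
Qed.

Lemma mxLnorm_U : mxLnorm p%:E U = 1%E.
Proof.
apply: rLnorm_ae1; first by rewrite gt_eqF // (lt_le_trans _ p2).
- exact/measurable_op_norm/U_measurable.
- by move=> x; exact: op_norm_ge0.
- by apply: filterS U_isometry => x; exact: op_norm_isometry.
Qed.

(** The trace pairing gives [o >= 1 - psi] pointwise, with [psi] of mean zero. The tangent
    inequality turns this into [o^p >= 1 - p psi], so L^p is reached without a separate comparison
    of norms. *)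
Lemma mxLnorm_UB_ge1 (F : T -> 'M[C]_2) : mx_Hardy p%:E F ->
  (1 <= mxLnorm p%:E (fun x => (U x - F x)%R))%E.
Proof.
move=> hF; have [hP uP _] := hPsi; have [hQoo uQ _] := hQ.
have hF2 : mxH2 F by move=> i j; apply: Hardy_H2 (hF i j); rewrite lee_fin.
have QF := mx_HardyooM hQoo hF2.
pose psi (x : T) := complex.Re ((x : C) * \tr (Q x *m F x)).
have psiE : (fun x : T => (x : C) * \tr (Q x *m F x)) =
    (fun x => \sum_(i < 2) (Q x *m F x) i i * (x : C) ^ 1).
  by apply/funext => x; rewrite mulrC mulr_suml.
have cpsi : cintegrable (fun x : T => (x : C) * \tr (Q x *m F x)).
  rewrite psiE.
  apply: (@cintegrable_sum R _ _ (fun i x => _)) => i.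
  exact: (cintegrable_coef 1 (QF i i).1).
(* This mean is the real part of the coefficient of index -1 of the analytic function [tr (Q F)]. *)
have Ipsi : \int[m]_x psi x = 0.
  rewrite -Re_cintegral psiE.
  rewrite (cintegral_sum _ (F := fun i x => (Q x *m F x) i i * (x : C) ^ 1)).
    rewrite big1 // => i _; have := (QF i i).2 (-1) (ltrN10 _).
    by rewrite /fourier_coef opprK.
  by move=> i; exact: (cintegrable_coef 1 (QF i i).1).
have [->|fin] := eqVneq (mxLnorm p%:E (fun x => U x - F x)) +oo%E; first exact: leey.
have p0 : 0 < p by rewrite (lt_le_trans _ p2).
have p1 : 1 < p by rewrite (lt_le_trans _ p2) // ltr1n.
set o := fun x => op_norm (U x - F x).
have o0 x : 0 <= o x by exact: op_norm_ge0.
have mo : measurable_fun setT o.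
  apply: measurable_op_norm; apply: mx_measurableB; first exact: U_measurable.
  exact: mx_Hardy_measurable hF.
have ho : rint (fun x => o x `^ p).
  by apply: rLnorm_rint => //; rewrite ltey.
rewrite /mxLnorm (rLnorm_powR (lt0r_neq0 p0) o0 ho) lee_fin.
suff h : 1 <= \int[m]_x o x `^ p.
  apply: (@le_trans _ _ (1 `^ p^-1)); first by rewrite powR1.
  by rewrite ge0_ler_powR ?nnegrE ?invr_ge0 ?(ltW p0) // (le_trans _ h).
have -> : 1 = \int[m]_x (1 - p * psi x).
  rewrite (intB (rint_cst 1) (rintZ p cpsi.1)) int_cst (intZ p cpsi.1).
  by rewrite -/(Rintegral _ _ psi) Ipsi mulr0 subr0.
apply: int_ae_le => //.
  by apply: rintB; [exact: rint_cst|apply: rintZ; exact: cpsi.1].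
near=> x.
have uPx : Psi x \in unitmx by near: x.
have uQx : Q x \in unitmx by near: x.
have AQx : A x *m A x = Q x *m adj (Q x) by near: x.
have tPx : \tr (adj (Psi x) *m Psi x) = 1 by near: x.
apply: le_trans (powR_ge_tangent (o0 x) p1).
rewrite lerD2l -mulrN ler_pM2l //.
have := Re_tr_le uPx erefl AQx (U x - F x) (sq_circle x) tPx.
rewrite mulmxBr raddfB /= mulrBr ReD ReN -/(psi x) -/(o x).
rewrite (_ : (x : C) * \tr (Q x *m U x) = 1) /=; first by lra.
rewrite /U -scalemxAr mxtraceZ mulrA [X in X * _]mulrC conj_mul sq_circle mul1r.
by rewrite mulmxA mulmxV // mul1mx /A mxtrace_mulC.
Unshelve. all: by end_near.
Qed.

Lemma distH_U : distH p%:E U = 1%E.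
Proof.
apply/eqP; rewrite eq_le; apply/andP; split.
  apply: ereal_inf_lbound; exists (fun=> 0); last first.
    by rewrite -mxLnorm_U; congr (mxLnorm _ _); apply/funext => x /=; rewrite subr0.
  move=> i j /=; under eq_fun do rewrite mxE; apply: Hardy0.
  by rewrite eqe gt_eqF // (lt_le_trans _ p2).
by apply: le_ereal_inf_tmp => _ [F hF <-]; exact: mxLnorm_UB_ge1.
Qed.

Lemma mxLspace_U : mxLspace p%:E U.
Proof. by split; [exact: U_measurable|rewrite mxLnorm_U ltry]. Qed.

(** Otherwise [F = U] would be allowed in [mxLnorm_UB_ge1], giving [1 <= 0]. *)
Lemma not_mx_Hardy_U : ~ mx_Hardy p%:E U.
Proof.
move=> /mxLnorm_UB_ge1; have -> : (fun x => U x - U x) = fun=> 0.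
  by apply/funext => x; rewrite subrr.
rewrite /mxLnorm /rLnorm (_ : (_ \o _) = cst 0%E); last first.
  apply/funext => x /=; rewrite op_normE /opsq /gram1 /gram2 /gram12 !mxE.
  by rewrite !mulr0 !addr0 !sq0 !addr0 subrr expr0n mulr0 addr0 sqrtr0 addr0 mul0r sqrtr0.
rewrite Lnorm0 ?eqe ?gt_eqF ?(lt_le_trans _ p2) //.
by rewrite lee_fin ler10.
Qed.

End BadApproximation.

(** * Norm of the Hankel operator *)

Section DualBasis.
Variable R : realType.
Local Notation T := (circle R).
Local Notation m := (@circle_measure R).

Lemma rint_sum (I : Type) (s : seq I) (F : I -> T -> R) :
  (forall i, rint (F i)) -> rint (fun x => \sum_(i <- s) F i x).
Proof.
move=> hF; elim: s => [|i s IH].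
  by under eq_fun do rewrite big_nil; exact: rint_cst.
by under eq_fun do rewrite big_cons; exact: rintD.
Qed.

Lemma int_sum (I : Type) (s : seq I) (F : I -> T -> R) :
  (forall i, rint (F i)) ->
  \int[m]_x (\sum_(i <- s) F i x) = \sum_(i <- s) \int[m]_x F i x.
Proof.
move=> hF; elim: s => [|i s IH].
  by under eq_Rintegral do rewrite big_nil; rewrite big_nil int_cst.
under eq_Rintegral do rewrite big_cons.
by rewrite big_cons intD ?IH //; exact: rint_sum.
Qed.

Lemma rint_bounded (f : T -> R) (K : R) : measurable_fun setT f ->
  (forall x, `|f x| <= K) -> rint f.
Proof. by move=> mf fK; apply: (rint_le mf fK); exact: rint_cst. Qed.

(* The Gram matrix is invertible, so the coefficients of a combination L are
   the integrals of L against bounded functions. *)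
Lemma dual_bound n (e : 'I_n -> T -> R) (M : R) :
  (forall i, measurable_fun setT (e i)) -> (forall i x, `|e i x| <= M) ->
  (forall v : 'I_n -> R, {ae m, forall x, \sum_i v i * e i x = 0} ->
    forall i, v i = 0) ->
  exists K : R, 0 < K /\ forall (v : 'I_n -> R) i,
    `|v i| <= K * \int[m]_x `|\sum_j v j * e j x|.
Proof.
move=> me eM indep.
have ee i j : rint (fun x => e i x * e j x).
  apply: (@rint_bounded _ (M * M)); first exact: measurable_funM.
  by move=> x; rewrite normrM ler_pM.
have re i : rint (e i) by exact: rint_bounded (me i) (eM i).
pose L (v : 'I_n -> R) x := \sum_j v j * e j x.
have rL v : rint (L v) by apply: rint_sum => j; exact: rintZ.
have mL v : measurable_fun setT (L v) by exact: rint_measurable.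
have Le v j x : L v x * e j x = \sum_i v i * (e i x * e j x).
  by rewrite mulr_suml; apply: eq_bigr => i _; rewrite mulrA.
have rLe v j : rint (fun x => L v x * e j x).
  by under eq_fun do rewrite Le; apply: rint_sum => i; exact: rintZ.
pose G : 'M[R]_n := \matrix_(i, j) \int[m]_x (e i x * e j x).
have vG v j : ((\row_i v i) *m G) 0 j = \int[m]_x (L v x * e j x).
  rewrite mxE; under eq_Rintegral do rewrite Le.
  rewrite int_sum; last by move=> i; exact: rintZ.
  by apply: eq_bigr => i _; rewrite !mxE intZ.
(* For [v] in the kernel, [L v] is orthogonal to every [e j], hence to itself. *)
have uG : G \in unitmx.
  rewrite unitmxE unitfE; apply/det0P => -[v v0 vG0].
  have vE : v = \row_i v 0 i by apply/rowP => i; rewrite mxE.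
  have LL x : L (v 0) x ^+ 2 = \sum_j v 0 j * (L (v 0) x * e j x).
    by rewrite expr2 {2}/L mulr_sumr; apply: eq_bigr => j _; rewrite mulrCA.
  have ILL : \int[m]_x (L (v 0) x ^+ 2) = 0.
    under eq_Rintegral do rewrite LL.
    rewrite int_sum; last by move=> j; exact: rintZ.
    by apply: big1 => j _; rewrite intZ // -vG -vE vG0 mxE mulr0.
  have rLL : rint (fun x => L (v 0) x ^+ 2).
    by under eq_fun do rewrite LL; apply: rint_sum => j; exact: rintZ.
  have := int_eq0_ae rLL (fun x => sqr_ge0 _) ILL => L0.
  case/eqP: v0; apply/rowP => i; rewrite mxE; apply: indep.
  by apply: filterS L0 => x /eqP; rewrite sqrf_eq0 => /eqP.
(* The summand 1 keeps [K] positive even when [n = 0]. *)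
pose K := 1 + \sum_j \sum_i `|invmx G j i| * `|M|.
have S0 : 0 <= \sum_j \sum_i `|invmx G j i| * `|M|.
  by apply: sumr_ge0 => j _; apply: sumr_ge0 => i _; rewrite mulr_ge0.
exists K; split; first by rewrite ltr_pwDl.
move=> v i; set N := \int[m]_x `|L v x|.
have N0 : 0 <= N by apply: int_ge0.
have rN : rint (fun x => `|L v x|) by exact: (integrable_norm (rL v)).
have bnd j : `|\int[m]_x (L v x * e j x)| <= `|M| * N.
  apply: le_trans (le_normr_Rintegral measurableT (rLe v j)) _.
  rewrite -intZ //; apply: int_le; [exact: (integrable_norm (rLe v j))|exact: rintZ|].
  by move=> x; rewrite normrM mulrC ler_wpM2r // (le_trans (eM j x)) // ler_norm.
have -> : v i = \sum_j (\int[m]_x (L v x * e j x)) * invmx G j i.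
  have <- : ((\row_i v i) *m G *m invmx G) 0 i = v i by rewrite mulmxK // mxE.
  by rewrite mxE; apply: eq_bigr => j _; rewrite vG.
apply: (@le_trans _ _ (\sum_j `|invmx G j i| * `|M| * N)).
  apply: le_trans (ler_norm_sum _ _ _) _; apply: ler_sum => j _.
  by rewrite normrM mulrC -mulrA ler_wpM2l.
rewrite -mulr_suml ler_wpM2r // /K (@le_trans _ _ (\sum_j \sum_i `|invmx G j i| * `|M|)) //.
  apply: ler_sum => j _; rewrite (bigD1 i) //= lerDl.
  by apply: sumr_ge0 => k _; rewrite mulr_ge0.
by rewrite lerDr.
Qed.

(** The exponent 2 is interpolated between 1 and [r]: the weights satisfy [t1 + t2 = 1] and
    [t1 + r t2 = 2], so [x^2] is the product of [x^t1] and [(x^r)^t2]. *)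
Lemma powR_young (x r : R) : 0 <= x -> 2 < r ->
  x ^+ 2 <= (r - 2) / (r - 1) * x + (r - 1)^-1 * x `^ r.
Proof.
move=> x0 r2; set t1 := (r - 2) / (r - 1); set t2 := (r - 1)^-1.
have r1 : 0 < r - 1 by lra.
have t10 : 0 < t1 by rewrite divr_gt0 //; lra.
have t20 : 0 < t2 by rewrite invr_gt0.
have t12 : t1 + t2 = 1 by rewrite /t1 /t2; field; rewrite gt_eqF.
have e2 : t1 + r * t2 = 2 by rewrite /t1 /t2; field; rewrite gt_eqF.
have i1 : 0 < t1^-1 by rewrite invr_gt0.
have i2 : 0 < t2^-1 by rewrite invr_gt0.
have i12 : t1^-1^-1 + t2^-1^-1 = 1 by rewrite !invrK.
move: t1 t2 t10 t20 t12 e2 i1 i2 i12 => t1 t2 t10 t20 t12 e2 i1 i2 i12.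
have := conjugate_powR (powR_ge0 x t1) (powR_ge0 x (r * t2)) i1 i2 i12.
rewrite -powRD ?e2 ?pnatr_eq0 // -!powRrM mulfV ?gt_eqF // -mulrA mulfV ?gt_eqF //.
by rewrite mulr1 powRr1 // powR2 // !invrK mulrC [_ * t2]mulrC.
Qed.

(* Integrating Young's inequality [u^2 <= t u + (1 - t) u^q], [t > 0], bounds the
   integral of u from below, which is all that [(u - 1)^2] needs. *)
Lemma Lnorm_gap (q : \bar R) : (2 < q)%E -> exists k : R, 0 <= k /\
  forall u : T -> R, measurable_fun setT u -> (forall x, 0 <= u x) ->
  rint (fun x => u x ^+ 2) -> (rLnorm q u <= 1)%E ->
  \int[m]_x (u x ^+ 2) <= 1 /\
  \int[m]_x ((u x - 1) ^+ 2) <= k * (1 - \int[m]_x (u x ^+ 2)).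
Proof.
move=> q2.
have ru (u : T -> R) : measurable_fun setT u -> (forall x, 0 <= u x) ->
    rint (fun x => u x ^+ 2) -> rint u.
  move=> mu u0 hu; apply: (rint_le mu _ (rintD (rint_cst 1) hu)) => x.
  by rewrite ger0_norm // -subr_ge0; have := sqr_ge0 (u x - 1); have := u0 x; nra.
have E (u : T -> R) : rint u -> rint (fun x => u x ^+ 2) -> \int[m]_x ((u x - 1) ^+ 2) =
    \int[m]_x (u x ^+ 2) - 2 * (\int[m]_x u x) + 1.
  move=> h1 h2; rewrite -(intZ 2 h1) -intB //; last exact: rintZ.
  rewrite -[X in _ + X](int_cst 1) -intD.
  - by apply: eq_Rintegral => x _; ring.
  - by apply: rintB => //; exact: rintZ.
  - exact: rint_cst.
have P (u : T -> R) : rint (fun x => (u x - 1) ^+ 2) -> 0 <= \int[m]_x ((u x - 1) ^+ 2).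
  by move=> _; apply: int_ge0 => x; exact: sqr_ge0.
have Q (u : T -> R) : rint u -> rint (fun x => u x ^+ 2) -> rint (fun x => (u x - 1) ^+ 2).
  move=> h1 h2; under eq_fun => x.
    have -> : (u x - 1) ^+ 2 = (u x ^+ 2 - 2 * u x) + 1 by ring.
    over.
  by apply: rintD; [apply: rintB => //; exact: rintZ|exact: rint_cst].
case: q q2 => [r|_|//].
- rewrite lte_fin => r2; have r0 : 0 < r by lra.
  set t1 := (r - 2) / (r - 1); set t2 := (r - 1)^-1.
  have r1 : 0 < r - 1 by lra.
  have t10 : 0 < t1 by rewrite divr_gt0 //; lra.
  have t20 : 0 < t2 by rewrite invr_gt0.
  have t12 : t1 + t2 = 1 by rewrite /t1 /t2; field; rewrite gt_eqF.
  (* Let [V] and [W] be the integrals of [u^2] and [u]. Inserting [t1 W >= V - t2] bounds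
     [t1 (V - 2 W + 1)] by [(2 - t1) (1 - V)], hence by [2 (1 - V)]. *)
  exists (2 / t1); split; first by rewrite divr_ge0 // ltW.
  move=> u mu u0 hu2 hq.
  have hu := ru u mu u0 hu2.
  have hr : rint (fun x => u x `^ r).
    by apply: rLnorm_rint => //; exact: le_lt_trans hq (ltry _).
  have Ir : \int[m]_x u x `^ r <= 1.
    have Ir0 : 0 <= \int[m]_x u x `^ r by apply: int_ge0 => x; exact: powR_ge0.
    move: hq; rewrite (rLnorm_powR (lt0r_neq0 r0) u0 hr) lee_fin => h.
    have -> : \int[m]_x u x `^ r = ((\int[m]_x u x `^ r) `^ r^-1) `^ r.
      by rewrite -powRrM mulVf ?powRr1 // gt_eqF.
    apply: (@le_trans _ _ (1 `^ r)); last by rewrite powR1.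
    by rewrite ge0_ler_powR ?nnegrE ?powR_ge0 // ltW.
  have Y : \int[m]_x (u x ^+ 2) <= t1 * (\int[m]_x u x) + t2.
    apply: (@le_trans _ _ (\int[m]_x (t1 * u x + t2 * u x `^ r))).
      apply: int_le => //; first by apply: rintD; exact: rintZ.
      by move=> x; exact: powR_young.
    rewrite intD; [|exact: rintZ|exact: rintZ].
    by rewrite !intZ // lerD2l ger_pMr.
  have P1 := P _ (Q _ hu hu2); rewrite E // in P1; rewrite E //.
  set V := \int[m]_x (u x ^+ 2) in Y P1 *; set W := \int[m]_x u x in Y P1 *.
  (* Since [W <= (V + 1) / 2], Young's bound yields [(1 - t1 / 2) V <= 1 - t1 / 2]. *)
  split; first by nra.
  have h : t1 * (V - 2 * W + 1) <= 2 * (1 - V) by nra.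
  by rewrite mulrAC ler_pdivlMr // mulrC.
(* Here [u <= 1] gives [u^2 <= u], so [V <= W] and [V - 2 W + 1 <= 1 - V]. *)
- exists 1; split => // u mu u0 hu2 hq.
  have hu := ru u mu u0 hu2.
  have u1 : {ae m, forall x, u x <= 1}.
    have := rLnorm_oo (le_lt_trans hq (ltry 1)).
    apply: filterS => x h; have := le_trans h hq.
    by rewrite lee_fin ger0_norm.
  have Y : \int[m]_x (u x ^+ 2) <= \int[m]_x u x.
    by apply: int_ae_le => //; apply: filterS u1 => x h; have := u0 x; nra.
  have W1 : \int[m]_x u x <= 1.
    by rewrite -(int_cst 1); apply: int_ae_le => //; exact: rint_cst.
  by rewrite E //; split; lra.
Qed.

End DualBasis.

(** * Vector functions and the values of the Hankel operator *)

Section VectorFunctions.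
Variable R : realType.
Local Notation C := R[i].
Local Notation T := (circle R).
Local Notation m := (@circle_measure R).
Implicit Types f g h : T -> 'cV[C]_2.

Definition vL2 f : Prop := forall i, L2 (fun x => f x i 0).

Lemma rint_vsq f : vL2 f -> rint (fun x => vsq (f x)).
Proof. by move=> hf; apply: rint_sum => i; exact: (hf i).2. Qed.

Lemma vL2_rint f : mx_measurable f -> rint (fun x => vsq (f x)) -> vL2 f.
Proof.
move=> mf hf i; split; first exact: mf.
apply: rint_le hf; first exact: measurable_sq.
move=> x; rewrite ger0_norm ?sq_ge0 // /vsq (bigD1 i) //= lerDl.
by apply: sumr_ge0 => j _; exact: sq_ge0.
Qed.

Lemma vL2_measurable f : vL2 f -> mx_measurable f.
Proof. by move=> hf i j; rewrite ord1; exact: (hf i).1. Qed.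

Lemma mxH2_vL2 f : mxH2 f -> vL2 f.
Proof. by move=> hf i; exact: (hf i 0).1. Qed.

Lemma vL2B f g : vL2 f -> vL2 g -> vL2 (fun x => f x - g x).
Proof. by move=> hf hg i; under eq_fun do rewrite !mxE; exact: L2B. Qed.

Lemma mxH2_Hardy f : mxH2 f -> mx_Hardy 2 f.
Proof. by move=> hf i j; exact: H2_Hardy. Qed.

Lemma measurable_vsq f : mx_measurable f -> measurable_fun setT (fun x => vsq (f x)).
Proof.
move=> mf; under eq_fun do rewrite vsqE.
by apply: measurable_funD; apply: measurable_sq; exact: mf.
Qed.

Lemma measurable_eucl_norm f : mx_measurable f ->
  measurable_fun setT (fun x => eucl_norm (f x)).
Proof.
move=> mf; under eq_fun do rewrite eucl_normE.
exact/measurable_sqrt/measurable_vsq.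
Qed.

Lemma eucl_norm_powR f :
  (fun x => eucl_norm (f x) `^ 2) = (fun x => vsq (f x)).
Proof. by apply/funext => x; rewrite powR2 ?eucl_norm_ge0 // eucl_norm2. Qed.

Lemma vLnorm2E f : rint (fun x => vsq (f x)) ->
  vLnorm 2 f = (Num.sqrt (\int[m]_x vsq (f x)))%:E.
Proof.
move=> hf.
have hf' : rint (fun x => eucl_norm (f x) `^ 2) by rewrite eucl_norm_powR.
rewrite /vLnorm (rLnorm_powR _ (fun x => eucl_norm_ge0 (f x)) hf') //.
rewrite eucl_norm_powR powR12_sqrt //.
by apply: int_ge0 => x; exact: vsq_ge0.
Qed.

Lemma vLspace2_vL2 f : vLspace 2 f -> vL2 f.
Proof.
move=> [mf hf]; apply: vL2_rint => //; rewrite -eucl_norm_powR.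
apply: rLnorm_rint hf => //; first by move=> x; exact: eucl_norm_ge0.
exact: measurable_eucl_norm.
Qed.

Lemma innerE g h : inner g h = cintegral (fun x => (adj (h x) *m g x) 0 0).
Proof.
congr cintegral; apply/funext => x; rewrite mxE.
by apply: eq_bigr => i _; rewrite adjE mulrC.
Qed.

Lemma cintegrable_adj g h : vL2 g -> vL2 h -> cintegrable (fun x => (adj (h x) *m g x) 0 0).
Proof.
move=> hg hh; under eq_fun do rewrite mxE.
apply: (@cintegrable_sum R _ _ (fun i x => _)) => i; under eq_fun do rewrite adjE.
by apply: L2_cintegrableM => //; exact: L2J.
Qed.

Lemma cmeasurable_adj g h : mx_measurable g -> mx_measurable h ->
  cmeasurable (fun x => (adj (h x) *m g x) 0 0).
Proof. by move=> mg mh; apply: mx_measurable_mul => //; exact: mx_measurable_adj. Qed.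

Lemma vsqD (x y : 'cV[C]_2) :
  vsq (x + y) = vsq x + vsq y + 2 * complex.Re ((adj x *m y) 0 0).
Proof.
rewrite mxE raddf_sum /= /vsq mulr_sumr -!big_split; apply: eq_bigr => i _.
by rewrite adjE mxE /sq !ReImE /=; ring.
Qed.

Lemma vsqN (x : 'cV[C]_2) : vsq (- x) = vsq x.
Proof. by apply: eq_bigr => i _; rewrite mxE sqN. Qed.

(** Expand [|f - d|^2 - 1] around [|f| = 1]. The weight is spent so that the small quantities, [d]
    and [|f| - 1], carry [t^-1] and the merely bounded ones carry [t]. *)
Lemma vsq_dist_le (f d : 'cV[C]_2) (t : R) : 0 < t ->
  `|vsq (f - d) - 1| <=
  (1 + t^-1) * (vsq d + (eucl_norm f - 1) ^+ 2) + t * vsq f + t.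
Proof.
move=> t0; have it : 0 < t^-1 by rewrite invr_gt0.
have h1 := Re_adj_mul_le f d it; have h2 := Re_adj_mul_le f (- d) it.
rewrite invrK in h1; rewrite invrK vsqN in h2.
rewrite vsqD vsqN; move: h1 h2.
rewrite (_ : (adj f *m - d) 0 0 = - (adj f *m d) 0 0); last by rewrite mulmxN [LHS]mxE.
rewrite ReN; set X := complex.Re _ => h1 h2.
rewrite -(eucl_norm2 f) in h1 h2 *; set u := eucl_norm f in h1 h2 *.
set w := u - 1; have uE : u ^+ 2 = 1 + 2 * w + w ^+ 2 by rewrite /w; ring.
have h3 : 2 * w <= t^-1 * w ^+ 2 + t.
  rewrite -subr_ge0 (_ : _ - _ = t^-1 * (w - t) ^+ 2); last by field; rewrite gt_eqF.
  by rewrite mulr_ge0 ?sqr_ge0 // ltW.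
have h4 : - (2 * w) <= t^-1 * w ^+ 2 + t.
  rewrite -subr_ge0 (_ : _ - _ = t^-1 * (w + t) ^+ 2); last by field; rewrite gt_eqF.
  by rewrite mulr_ge0 ?sqr_ge0 // ltW.
have d0 := vsq_ge0 d; have w0 := sqr_ge0 w.
have d1 : 0 <= t^-1 * vsq d by rewrite mulr_ge0 // ltW.
by rewrite ler_norml; apply/andP; split; lra.
Qed.

Lemma ess_bounded_mul_bound (F : T -> 'M[C]_2) :
  (forall i j, ess_bounded (fun x => F x i j)) ->
  exists K : R, 0 < K /\ {ae m, forall x, forall y, vsq (F x *m y) <= K * vsq y}.
Proof.
move=> hF.
have [_ [a [a0 ha]]] := hF 0 0; have [_ [b [b0 hb]]] := hF 0 1.
have [_ [c [c0 hc]]] := hF 1 0; have [_ [d [d0 hd]]] := hF 1 1.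
(* The sum bounds the squared Hilbert-Schmidt norm, the 2 comes from [sqD_le], and the 1 ensures
   positivity. *)
exists (2 * (a + b + c + d) + 1); split.
  by rewrite ltr_wpDl // mulr_ge0 // !addr_ge0.
near=> x; move=> y.
have xa : sq (F x 0 0) <= a by near: x.
have xb : sq (F x 0 1) <= b by near: x.
have xc : sq (F x 1 0) <= c by near: x.
have xd : sq (F x 1 1) <= d by near: x.
rewrite !vsqE !mulmx2E.
have h1 := sqD_le (F x 0 0 * y 0 0) (F x 0 1 * y 1 0).
have h2 := sqD_le (F x 1 0 * y 0 0) (F x 1 1 * y 1 0).
rewrite !sqM in h1 h2.
have y0 := sq_ge0 (y 0 0); have y1 := sq_ge0 (y 1 0).
have k1 := ler_wpM2r y0 xa; have k2 := ler_wpM2r y1 xb.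
have k3 := ler_wpM2r y0 xc; have k4 := ler_wpM2r y1 xd.
have n1 := mulr_ge0 a0 y1; have n2 := mulr_ge0 b0 y0.
have n3 := mulr_ge0 c0 y1; have n4 := mulr_ge0 d0 y0.
by lra.
Unshelve. all: by end_near.
Qed.

(** [xget] returns its default 0 if no projection exists. Keeping that case open avoids constructing
    the projection: a zero value is never nearly maximal. *)
Lemma Hankel_cases (Phi : T -> 'M[C]_2) f :
  Hankel Phi f = cst 0 \/
  (H2minus (Hankel Phi f) /\
   forall h, H2minus h -> inner ((fun x => Phi x *m f x) \- Hankel Phi f) h = 0).
Proof.
rewrite /Hankel /Pminus; set S := (X in xget _ X).
have [[g Sg]|nS] := pselect (exists g, S g).
  by right; exact: (xgetPex (cst 0) (ex_intro _ g Sg)).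
by left; rewrite xgetPN // => g Sg; apply: nS; exists g.
Qed.

End VectorFunctions.

(** * Vectors that nearly attain the Hankel norm *)

Section NearMaximizers.
Variable R : realType.
Local Notation C := R[i].
Local Notation T := (circle R).
Local Notation m := (@circle_measure R).
Variables (q : \bar R) (Psi Q : T -> 'M[C]_2).
Hypothesis q2 : (2 < q)%E.
Hypotheses (hPsi : invertible_Hoo Psi) (hQ : invertible_Hoo Q).
Let A (x : T) : 'M[C]_2 := Psi x *m adj (Psi x).
Hypothesis AQ : {ae m, forall x, A x *m A x = Q x *m adj (Q x)}.
Let U (x : T) : 'M[C]_2 := (x : C)^*%C *: (invmx (Q x) *m A x).

Lemma mx_Hardyoo_ess_bounded (F : T -> 'M[C]_2) : mx_Hardy +oo%E F ->
  forall i j, ess_bounded (fun x => F x i j).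
Proof. by move=> hF i j; exact: Hardyoo_ess_bounded. Qed.

(* With [k = Psi^-1 f] and [k0 = k - c] its part of mean zero, the function
   [h = conj z Q^-1 Psi k0] is analytic, and [<k0, k> = <Uf, h>] pointwise.
   Integrating, [|k0|^2] becomes [<Uf, h> = <Uf - g, h>], since g is orthogonal
   to the analytic functions. *)
Lemma mean_zero_bound : exists K : R, 0 < K /\
  forall f g : T -> 'cV[C]_2, mxH2 f -> vL2 g ->
  (forall h, mx_Hardy 2 h -> inner g h = 0) ->
  exists c : 'cV[C]_2,
    \int[m]_x vsq (f x - Psi x *m c) <=
      K * \int[m]_x vsq (U x *m f x - g x).
Proof.
have [hP uP hPi] := hPsi; have [hQoo uQ hQi] := hQ.
have [K1 [K10 hK1]] := ess_bounded_mul_bound (mx_Hardyoo_ess_bounded hP).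
have [K2 [K20 hK2]] := ess_bounded_mul_bound (mx_Hardyoo_ess_bounded hQi).
have [K [K0 KE]] := ex_intro (fun K => 0 < K /\ K = K1 * K2) _
  (conj (mulr_gt0 K10 K20) erefl).
exists (K1 * K); split; first by rewrite mulr_gt0.
move=> f g hf hg g0.
pose k (x : T) := invmx (Psi x) *m f x.
have hk : mxH2 k by exact: mx_HardyooM.
pose c : 'cV[C]_2 := \col_i cintegral (fun x => k x i 0).
pose k0 (x : T) := k x - c.
have hk0 : mxH2 k0.
  move=> i j; rewrite ord1; under eq_fun do rewrite /k0 mxE.
  by apply: H2D; [exact: hk|exact: H2_cst].
have mk0 i : cintegral (fun x => k0 x i 0) = 0.
  have -> : (fun x => k0 x i 0) = (fun x => k x i 0 - cintegral (fun x => k x i 0)).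
    by apply/funext => x; rewrite /k0 mxE [X in _ + X]mxE; congr (_ - _); rewrite mxE.
  rewrite (cintegralB (L2_cintegrable (hk i 0).1) (L2_cintegrable (L2_cst _))).
  by rewrite cintegral_cst subrr.
pose z0 (x : T) := (x : C)^*%C *: k0 x.
have hz0 : mxH2 z0.
  move=> i j; rewrite ord1; under eq_fun do rewrite /z0 mxE.
  exact: H2_shift.
pose h (x : T) := invmx (Q x) *m (Psi x *m z0 x).
have hh : mxH2 h by apply: mx_HardyooM => //; exact: mx_HardyooM.
have hE x : h x = (x : C)^*%C *: (invmx (Q x) *m (Psi x *m k0 x)).
  by rewrite /h /z0 -!scalemxAr.
exists c.
have lf := mxH2_vL2 hf; have lk := mxH2_vL2 hk; have lk0 := mxH2_vL2 hk0.
have lh := mxH2_vL2 hh.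
have mU := U_measurable hPsi hQ.
have mUf : mx_measurable (fun x => U x *m f x).
  by apply: mx_measurable_mul mU _; exact: vL2_measurable.
have lUf : vL2 (fun x => U x *m f x).
  apply: vL2_rint => //; apply: (rint_ae_le _ _ (rint_vsq lf)).
    exact: measurable_vsq.
  apply: filterS (U_isometry hPsi hQ AQ) => x hx.
  by rewrite vsq_isometry // ger0_norm ?vsq_ge0.
have lr := vL2B lUf hg.
set r := fun x => U x *m f x - g x; rewrite -/r in lr.
(* Having mean zero, [k0] is orthogonal to the constant [c = k - k0]. *)
have E1 : \int[m]_x vsq (k0 x) = complex.Re (cintegral (fun x => (adj (k0 x) *m k x) 0 0)).
  have lc : vL2 (fun=> c) by move=> i; exact: L2_cst.
  have -> : \int[m]_x vsq (k0 x) =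
      complex.Re (cintegral (fun x => (adj (k0 x) *m k0 x) 0 0)).
    by rewrite Re_cintegral; apply: eq_Rintegral => x _; rewrite vsq_adj.
  have -> : (fun x => (adj (k0 x) *m k0 x) 0 0) =
      (fun x => (adj (k0 x) *m k x) 0 0 - (adj (k0 x) *m c) 0 0).
    by apply/funext => x; rewrite {2}/k0 mulmxBr !mxE.
  rewrite cintegralB; [|exact: cintegrable_adj|exact: cintegrable_adj].
  have -> : cintegral (fun x => (adj (k0 x) *m c) 0 0) = 0; last by rewrite subr0.
  have -> : (fun x => (adj (k0 x) *m c) 0 0) =
      (fun x => \sum_i c i 0 * (k0 x i 0)^*%C).
    by apply/funext => x; rewrite mxE; apply: eq_bigr => i _; rewrite adjE mulrC.
  have ck i : cintegrable (fun x => (k0 x i 0)^*%C) by exact/L2_cintegrable/L2J.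
  rewrite (cintegral_sum _ (F := fun i x => c i 0 * (k0 x i 0)^*%C)).
    apply: big1 => i _; rewrite cintegralZ // cintegralJ ?mk0 ?conjc0 ?mulr0 //.
    exact: L2_cintegrable.
  by move=> i; exact: cintegrableZ.
have E2 : cintegral (fun x => (adj (k0 x) *m k x) 0 0) =
    cintegral (fun x => (adj (h x) *m r x) 0 0).
  transitivity (cintegral (fun x => (adj (h x) *m (U x *m f x)) 0 0)).
    apply: cintegral_ae_eq.
    - by apply: cmeasurable_adj; exact: vL2_measurable.
    - by apply: cmeasurable_adj => //; exact: vL2_measurable.
    - apply: filterS3 uP uQ AQ => x h1 h2 h3; congr (_ 0 0).
      by rewrite hE (symbol_duality h1 h2 erefl h3 _ _ (sq_conj_circle x)).
  transitivity (cintegral (fun x => (adj (h x) *m g x) 0 0 + (adj (h x) *m r x) 0 0)).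
    congr cintegral; apply/funext => x.
    have -> : U x *m f x = g x + r x by rewrite /r addrC subrK.
    by rewrite mulmxDr [LHS]mxE.
  rewrite cintegralD; [|exact: cintegrable_adj|exact: cintegrable_adj].
  by rewrite -innerE g0 ?add0r //; exact: mxH2_Hardy.
(* As [|h|^2 <= K |k0|^2], the weight [K] leaves [K^-1 |h|^2 <= |k0|^2], absorbed by one of the two
   copies of the integral of [|k0|^2] on the left. *)
have B1 : \int[m]_x vsq (k0 x) <= K * \int[m]_x vsq (r x).
  have rr := rint_vsq lr; have rk := rint_vsq lk0.
  suff : 2 * (\int[m]_x vsq (k0 x)) <= K * (\int[m]_x vsq (r x)) + \int[m]_x vsq (k0 x).
    by clear; move: (\int[m]_x _) (K * _) => a b; rewrite mulr_natl mulr2n lerD2r.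
  rewrite {1}E1 E2 Re_cintegral -(intZ 2 (cintegrable_adj lr lh).1) -(intZ K rr).
  rewrite -(intD (rintZ K rr) rk).
  apply: int_ae_le.
  - exact: (rintZ 2 (cintegrable_adj lr lh).1).
  - exact: (rintD (rintZ K rr) rk).
  - apply: filterS2 hK1 hK2 => x h1 h2.
    apply: le_trans (Re_adj_mul_le (h x) (r x) K0) _; rewrite lerD2l.
    rewrite (mulrC K^-1) (ler_pdivrMr _ _ K0) (hE x) vsqZ sq_conj_circle mul1r.
    apply: le_trans (h2 _) _.
    rewrite KE (mulrC (vsq _)) (mulrC K1) -[leRHS]mulrA (ler_pM2l K20).
    exact: h1.
clear E1 E2; rewrite -mulrA; apply: (@le_trans _ _ (K1 * \int[m]_x vsq (k0 x))).
  have mPc : mx_measurable (fun x => Psi x *m c).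
    apply: (mx_measurable_mul (mx_Hardy_measurable hP)) => i j.
    exact: cmeasurable_cst.
  have bnd : {ae m, forall x, vsq (f x - Psi x *m c) <= K1 * vsq (k0 x)}.
    apply: filterS2 uP hK1 => x h1 h2.
    by rewrite (_ : f x - Psi x *m c = Psi x *m k0 x) // mulmxBr mulKVmx.
  have rk := rintZ K1 (rint_vsq lk0).
  rewrite -(intZ K1 (rint_vsq lk0)).
  apply: (int_ae_le _ rk bnd); apply: (rint_ae_le _ _ rk).
    by apply: measurable_vsq; exact: (mx_measurableB (vL2_measurable lf) mPc).
  by apply: filterS bnd => x; rewrite ger0_norm ?vsq_ge0.
by rewrite (ler_pM2l K10).
Qed.

(** A norm of [H_U f] close to 1 has two effects: [U f - H_U f] is small, so [f] is near [Psi c];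
    and the L^2 norm of [f] is close to its L^q bound, so [|f|] is near 1. Since [t^-1] multiplies
    [e], the weight is left to the caller, to be fixed before [e]. *)
Lemma near_maximizer : exists K : R, 0 < K /\
  forall (e : R) f, 0 < e < 1 -> mx_Hardy q f -> (vLnorm q f <= 1)%E ->
  ((1 - e)%:E < vLnorm 2 (Hankel U f))%E ->
  exists c : 'cV[C]_2, forall t, 0 < t ->
    \int[m]_x `|vsq (Psi x *m c) - 1| <= (1 + t^-1) * (K * e) + 2 * t.
Proof.
have [K1 [K10 hK1]] := mean_zero_bound.
have [k [k0 hk]] := Lnorm_gap q2.
(* Both the squared norm of [U f - g] and [1 - V] turn out to be at most [2 e]; they enter with the
   factors [K1] and [k]. *)
exists (2 * K1 + 2 * k); split; first by apply: ltr_pwDl; [exact: mulr_gt0|exact: mulr_ge0].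
move=> e f /andP[e0 e1] hf fq fe.
have hf2 : mxH2 f by move=> i j; exact: Hardy_H2 (ltW q2) (hf i j).
have lf := mxH2_vL2 hf2; have rf := rint_vsq lf.
have mu := measurable_eucl_norm (vL2_measurable lf).
have uE : (fun x => eucl_norm (f x) ^+ 2) = (fun x => vsq (f x)).
  by apply/funext => x; exact: eucl_norm2.
have ru2 : rint (fun x => eucl_norm (f x) ^+ 2) by rewrite uE.
have [V1 gap] := hk _ mu (fun x => eucl_norm_ge0 (f x)) ru2 fq.
rewrite uE in V1 gap; set V := \int[m]_x vsq (f x) in V1 gap.
have [g0|[Hg orth]] := Hankel_cases U f.
  have v0 : (fun x : T => vsq ((cst 0 : T -> 'cV[C]_2) x)) = fun=> 0.
    by apply/funext => x; rewrite vsqE !mxE sq0 addr0.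
  move: fe; rewrite g0 vLnorm2E v0; last exact: rint_cst.
  by rewrite int_cst sqrtr0 lte_fin subr_lt0 ltNge (ltW e1).
set g := Hankel U f in fe Hg orth.
have lg := vLspace2_vL2 Hg.1; have rg := rint_vsq lg.
have [c hc] := hK1 f g hf2 lg Hg.2; exists c => t t0.
have mU := U_measurable hPsi hQ.
have mUf : mx_measurable (fun x => U x *m f x).
  by apply: mx_measurable_mul mU _; exact: vL2_measurable.
have vU : {ae m, forall x, vsq (U x *m f x) = vsq (f x)}.
  by apply: filterS (U_isometry hPsi hQ AQ) => x hx; rewrite vsq_isometry.
have lUf : vL2 (fun x => U x *m f x).
  apply: vL2_rint => //; apply: (rint_ae_le _ _ rf); first exact: measurable_vsq.
  by apply: filterS vU => x ->; rewrite ger0_norm ?vsq_ge0.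
have lr := vL2B lUf lg; set r := fun x => U x *m f x - g x in lr hc.
have rr := rint_vsq lr; set N := \int[m]_x vsq (r x) in hc.
(* Pythagoras: [r] is orthogonal to all of [H2minus], in particular to [g]. *)
have VE : V = (\int[m]_x vsq (g x)) + N.
  have -> : V = \int[m]_x vsq (U x *m f x).
    apply: int_ae_eq; [exact: rint_measurable rf|exact: measurable_vsq|].
    by apply: filterS vU => x ->.
  have E x : vsq (U x *m f x) =
      vsq (g x) + vsq (r x) + 2 * complex.Re ((adj (g x) *m r x) 0 0).
    by rewrite -vsqD /r addrC subrK.
  under eq_Rintegral do rewrite E.
  have cgr := (cintegrable_adj lr lg).1.
  rewrite (intD (rintD rg rr) (rintZ 2 cgr)) (intD rg rr) (intZ 2 cgr).
  by rewrite -Re_cintegral -innerE (orth g Hg) mulr0 addr0.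
have G1 : 1 - 2 * e <= \int[m]_x vsq (g x).
  have G0 : 0 <= \int[m]_x vsq (g x) by apply: int_ge0 => x; exact: vsq_ge0.
  move: fe; rewrite vLnorm2E // lte_fin => h.
  have : (1 - e) ^+ 2 <= \int[m]_x vsq (g x).
    rewrite -[leRHS]sqr_sqrtr // ler_sqr ?nnegrE ?sqrtr_ge0 ?(ltW h) //; lra.
  by have := sqr_ge0 e; nra.
have N0 : 0 <= N by apply: int_ge0 => x; exact: vsq_ge0.
have N2 : N <= 2 * e by lra.
pose d x := f x - Psi x *m c.
have [hP _ _] := hPsi.
have mPc : mx_measurable (fun x => Psi x *m c).
  apply: (mx_measurable_mul (mx_Hardy_measurable hP)) => i j.
    exact: cmeasurable_cst.
have lPc : vL2 (fun x => Psi x *m c).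
  have hc2 : mxH2 (fun _ : T => c) by move=> i j; exact: H2_cst.
  exact: mxH2_vL2 (mx_HardyooM hP hc2).
have ld : vL2 d by exact: vL2B.
have rd := rint_vsq ld.
have ru : rint (fun x => (eucl_norm (f x) - 1) ^+ 2).
  apply: (@rint_le _ _ (fun x => 2 * vsq (f x) + 2)).
  - by apply: measurable_funX; apply: measurable_funB => //; exact: measurable_cst.
  - move=> x; rewrite ger0_norm ?sqr_ge0 // -eucl_norm2.
    by have := sqr_ge0 (eucl_norm (f x) + 1); nra.
  - exact: (rintD (rintZ 2 rf) (rint_cst 2)).
have rdu := rintD rd ru.
have rS := rintZ (1 + t^-1) rdu.
have rV := rintZ t rf.
apply: (@le_trans _ _ (\int[m]_x ((1 + t^-1) * (vsq (d x) + (eucl_norm (f x) - 1) ^+ 2)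
   + t * vsq (f x) + t))).
  have rP := rint_vsq lPc.
  apply: int_le.
  - exact: (integrable_norm (rintB rP (rint_cst 1))).
  - exact: (rintD (rintD rS rV) (rint_cst t)).
  - move=> x; rewrite (_ : Psi x *m c = f x - d x); first exact: vsq_dist_le.
    by rewrite /d subKr.
rewrite (intD (rintD rS rV) (rint_cst t)) (intD rS rV) int_cst.
rewrite (intZ _ rdu) (intZ t rf) (intD rd ru) -/V.
have it : 0 < t^-1 by rewrite invr_gt0.
have h1 : \int[m]_x vsq (d x) <= K1 * (2 * e).
  by apply: le_trans hc _; rewrite (ler_pM2l K10).
have h2 : \int[m]_x ((eucl_norm (f x) - 1) ^+ 2) <= k * (2 * e).
  apply: le_trans gap _; apply: ler_wpM2l => //.
  by clear - VE G1 N0; lra.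
have h4 : t * V <= t by rewrite -[leRHS]mulr1 (ler_pM2l t0).
move: (\int[m]_x vsq (d x)) (\int[m]_x ((eucl_norm (f x) - 1) ^+ 2)) (t * V) h1 h2 h4.
move=> D W tV h1 h2 h4.
have h3 : (1 + t^-1) * (D + W) <= (1 + t^-1) * ((2 * K1 + 2 * k) * e).
  rewrite (ler_pM2l (addr_gt0 ltr01 it)).
  by apply: le_trans (lerD h1 h2) _; rewrite -mulrDl mulrCA mulrA mulrDr.
by rewrite -addrA; apply: lerD => //; rewrite mulr_natl mulr2n lerD2r.
Qed.

End NearMaximizers.

(** * The distance from [c^* B c] to the constant 1 *)

Section DistanceFromOne.
Variable R : realType.
Local Notation C := R[i].
Local Notation T := (circle R).
Local Notation m := (@circle_measure R).

Lemma sum_ord4 (F : 'I_4 -> R) : \sum_i F i =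
  F (@Ordinal 4 0 isT) + F (@Ordinal 4 1 isT) + F (@Ordinal 4 2 isT) + F (@Ordinal 4 3 isT).
Proof.
rewrite !big_ord_recl big_ord0 addr0 !addrA.
by congr (F _ + F _ + F _ + F _); exact: val_inj.
Qed.

(** Passing to real functions and real coefficients prepares for [dual_bound]; the [|c_1|^2] coming
    from the entry [1 - alpha] joins the constant term. *)
Lemma vsq_gram (P : 'M[C]_2) (a : R) (b : C) (c : 'cV[C]_2) :
  mx22 a%:C b b^* (1 - a)%:C = adj P *m P ->
  vsq (P *m c) - 1 = (sq (c 0 0) - sq (c 1 0)) * a
    + complex.Re ((c 0 0)^*%C * c 1 0) * (2 * complex.Re b)
    + complex.Im ((c 0 0)^*%C * c 1 0) * (- (2 * complex.Im b))
    + (sq (c 1 0) - 1) * 1.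
Proof.
move=> E.
have -> : vsq (P *m c) = complex.Re ((adj c *m (mx22 a%:C b b^* (1 - a)%:C *m c)) 0 0).
  by rewrite E -!mulmxA mulmxA -adjM vsq_adj.
rewrite [X in complex.Re X]mxE !big_ord_recl big_ord0 addr0 !adjE.
rewrite (_ : lift ord0 ord0 = 1); last exact: val_inj.
by rewrite !mulmx2E !mxE /= /sq !ReImE /=; ring.
Qed.

Variables (alpha : T -> R) (beta : T -> C) (Psi : T -> 'M[C]_2).
Hypothesis malpha : measurable_fun setT alpha.
Hypothesis balpha : exists M : R, forall x, `|alpha x| <= M.
Hypothesis mbeta : cmeasurable beta.
Hypothesis bbeta : exists M : R, forall x, normc (beta x) <= M.
Hypothesis indep : lin_indep4 (fun x => (alpha x)%:C) beta (fun x => (beta x)^*)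
    (fun=> 1).
Hypothesis mPsi : mx_measurable Psi.
Hypothesis BPsi : {ae m, forall x,
  mx22 (alpha x)%:C (beta x) (beta x)^* (1 - alpha x)%:C = adj (Psi x) *m Psi x}.

Lemma vsq_far_from_one : exists eta : R, 0 < eta /\
  forall c : 'cV[C]_2, eta <= \int[m]_x `|vsq (Psi x *m c) - 1|.
Proof.
have [M1 hM1] := balpha; have [M2 hM2] := bbeta.
pose e (i : 'I_4) (x : T) : R :=
  nth 0 [:: alpha x; 2 * complex.Re (beta x); - (2 * complex.Im (beta x)); 1] i.
have me i : measurable_fun setT (e i).
  case: i => -[|[|[|[|//]]]] i4; rewrite /e /=.
  - exact: malpha.
  - by apply: measurable_funM; [exact: measurable_cst|exact: mbeta.1].
  - apply: measurableT_comp => //.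
    by apply: measurable_funM; [exact: measurable_cst|exact: mbeta.2].
  - exact: measurable_cst.
have eM i x : `|e i x| <= M1 + 2 * M2 + 1.
  have m1 : 0 <= M1 by exact: le_trans (hM1 x).
  have m2 : 0 <= M2 by exact: le_trans (normc_ge0 _) (hM2 x).
  have nr : `|complex.Re (beta x)| <= M2.
    apply: le_trans (hM2 x).
    rewrite -ler_sqr ?nnegrE ?normc_ge0 // normcE2 real_normK ?num_real //.
    exact: Re2_le.
  have ni : `|complex.Im (beta x)| <= M2.
    apply: le_trans (hM2 x).
    rewrite -ler_sqr ?nnegrE ?normc_ge0 // normcE2 real_normK ?num_real //.
    exact: Im2_le.
  have n1 := hM1 x.
  case: i => -[|[|[|[|//]]]] i4; rewrite /e /= ?normrN ?normrM ?normr1;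
    rewrite ?(ger0_norm (ler0n _ 2)); lra.
have ind (v : 'I_4 -> R) : {ae m, forall x, \sum_i v i * e i x = 0} -> forall i, v i = 0.
  move=> h.
  (* A real relation in [2 Re beta] and [- 2 Im beta] is a complex one in [beta] and [conj beta]
     with conjugate coefficients [v_1 + i v_2] and [v_1 - i v_2]. *)
  have := @indep (v (@Ordinal 4 0 isT))%:C
    (v (@Ordinal 4 1 isT) +i* v (@Ordinal 4 2 isT))
    (v (@Ordinal 4 1 isT) +i* - v (@Ordinal 4 2 isT)) (v (@Ordinal 4 3 isT))%:C.
  case.
    apply: filterS h => x; rewrite sum_ord4 /e /= => h.
    by apply: complex_ext; rewrite !ReImE /=; [rewrite -[RHS]h|]; ring.
  move=> [h0] [h1 h2] _ [h3] [[|[|[|[|//]]]] i4].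
  - by rewrite -[RHS]h0; congr v; exact: val_inj.
  - by rewrite -[RHS]h1; congr v; exact: val_inj.
  - by rewrite -[RHS]h2; congr v; exact: val_inj.
  - by rewrite -[RHS]h3; congr v; exact: val_inj.
have [K [K0 hK]] := dual_bound me eM ind.
(* An integral below this value would make all four coefficients smaller than 1/4. *)
exists (4 * K)^-1; split; first by rewrite invr_gt0 mulr_gt0.
move=> c; pose y := (c 0 0)^*%C * c 1 0.
pose v (i : 'I_4) : R :=
  nth 0 [:: sq (c 0 0) - sq (c 1 0); complex.Re y; complex.Im y; sq (c 1 0) - 1] i.
have -> : \int[m]_x `|vsq (Psi x *m c) - 1| = \int[m]_x `|\sum_i v i * e i x|.
  apply: int_ae_eq.
  - apply: measurableT_comp => //; apply: measurable_funB; last exact: measurable_cst.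
    by apply/measurable_vsq/mx_measurable_mul => // i j; exact: cmeasurable_cst.
  - apply: measurableT_comp => //; apply: measurable_sum => i.
    by apply: measurable_funM; [exact: measurable_cst|exact: me].
  - by apply: filterS BPsi => x h; rewrite (vsq_gram c h) sum_ord4.
set N := \int[m]_x _.
rewrite leNgt; apply/negP => hN.
have {}hN : K * N < 4^-1.
  rewrite -(ltr_pM2l K0) in hN; apply: lt_le_trans hN _.
  by rewrite invfM mulrCA mulfV ?gt_eqF // mulr1.
have b i : `|v i| < 4^-1 by exact: le_lt_trans (hK v i) hN.
have := b (@Ordinal 4 0 isT); have := b (@Ordinal 4 1 isT).
have := b (@Ordinal 4 2 isT); have := b (@Ordinal 4 3 isT).
rewrite /v /= !ltr_norml.
have : complex.Re y ^+ 2 + complex.Im y ^+ 2 = sq (c 0 0) * sq (c 1 0).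
  by rewrite -[LHS]/(sq y) sqM sqJ.
move: (complex.Re y) (complex.Im y) (sq (c 0 0)) (sq (c 1 0)) => y1 y2 s0 s1 E.
move=> /andP[h1 h2] /andP[h3 h4] /andP[h5 h6] /andP[h7 h8].
(* Now [|y|^2 < 1/8], whereas [s1 > 3/4] and [s0 > 1/2] give [|y|^2 = s0 s1 > 3/8]. *)
have k1 : y1 ^+ 2 < 1/16 by nra.
have k2 : y2 ^+ 2 < 1/16 by nra.
have k3 : 3/4 < s1 by lra.
have k4 : 1/2 < s0 by lra.
have k5 : 3/8 < s0 * s1 by nra.
lra.
Qed.

End DistanceFromOne.

Local Open Scope sesquilinear_scope.

Theorem theorem5p4 (R : realType) (p : R) (q : \bar R)
    (alpha : circle R -> R) (beta : circle R -> R[i])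
    (Psi Q : circle R -> 'M[R[i]]_2) :
  2 <= p ->
  (2 < q)%E -> (p%:E^-1 + q^-1 = 2^-1)%E ->
  measurable_fun setT alpha ->
  (exists M : R, forall zeta, `|alpha zeta| <= M) ->
  cmeasurable beta ->
  (exists M : R, forall zeta, normc (beta zeta) <= M) ->
  lin_indep4 (fun zeta => (alpha zeta)%:C) beta (fun zeta => (beta zeta)^*)
    (fun=> 1) ->
  (exists2 delta : R, 0 < delta &
     {ae @circle_measure R, forall zeta,
        delta <= alpha zeta * (1 - alpha zeta)
                 - normc (beta zeta) ^+ 2}) ->
  let B := fun zeta => mx22 (alpha zeta)%:C (beta zeta)
                            (beta zeta)^* (1 - alpha zeta)%:C in
  invertible_Hoo Psi ->
  {ae @circle_measure R, forall zeta, B zeta = (Psi zeta)^t* *m Psi zeta} ->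
  let A := fun zeta => Psi zeta *m (Psi zeta)^t* in
  invertible_Hoo Q ->
  {ae @circle_measure R, forall zeta,
     A zeta *m A zeta = Q zeta *m (Q zeta)^t*} ->
  let U := fun zeta : circle R =>
    (zeta : R[i])^* *: (invmx (Q zeta) *m A zeta) in
  weird p%:E q U /\ badly_approximable p%:E U.
Proof.
move=> p2 q2 _ malpha balpha mbeta bbeta indep _ B hPsi BPsi A hQ AQ U.
have trPsi : {ae @circle_measure R, forall x, \tr (adj (Psi x) *m Psi x) = 1}.
  apply: filterS BPsi => x; rewrite -[X in X -> _]/(B x = adj (Psi x) *m Psi x) => <-.
  rewrite /mxtrace !big_ord_recl big_ord0 addr0 !mxE /= -rmorphD /=.
  by rewrite addrC subrK.
have LU : mxLspace p%:E U := mxLspace_U p2 hPsi hQ AQ.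
have distU : distH p%:E U = 1%E := distH_U p2 hPsi hQ AQ trPsi.
split; last first.
  by split => //; rewrite distU; exact: (mxLnorm_U p2 hPsi hQ AQ).
split => //; first exact: (not_mx_Hardy_U p2 hPsi hQ AQ trPsi).
case=> _ _; rewrite distU => HU.
have [K [K0 hK]] := near_maximizer q2 hPsi hQ AQ.
have mPsi : mx_measurable Psi by case: hPsi => /mx_Hardy_measurable.
have [eta [eta0 heta]] :=
  vsq_far_from_one malpha balpha mbeta bbeta indep mPsi BPsi.
(* The terms [2 t] and [(1 + t^-1) (K e)] each receive [eta / 4], a total of [eta / 2 < eta]. The
   cap 1/2 on [e] ensures [e < 1]. *)
pose t := eta / 8.
have t0 : 0 < t by rewrite divr_gt0.
have t1 : 0 < 1 + t^-1 by rewrite addr_gt0 // invr_gt0.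
pose e := Num.min 2^-1 (eta / (4 * (1 + t^-1) * K)).
have e0 : 0 < e by rewrite lt_min invr_gt0 ltr0n divr_gt0 // !mulr_gt0.
have e1 : e < 1 by rewrite gt_min invf_lt1 // ltr1n.
have e2 : (1 + t^-1) * (K * e) <= eta / 4.
  have h : e <= eta / (4 * (1 + t^-1) * K) by rewrite ge_min lexx orbT.
  rewrite ler_pdivlMr ?mulr_gt0 // in h.
  rewrite ler_pdivlMr //; apply: le_trans h.
  by rewrite le_eqVlt; apply/orP; left; apply/eqP; ring.
have lt1 : ((1 - e)%:E < Hankel_norm q U)%E by rewrite HU lte_fin gtrBl.
have [_ [f [hf fq] <-] fe] := ereal_sup_gt lt1.
have e01 : 0 < e < 1 by rewrite e0.
have [c hc] := hK e f e01 hf fq fe.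
have := le_trans (heta c) (hc t t0).
have tE : 2 * t = eta / 4 by rewrite /t; field.
by rewrite tE; lra.
Qed.
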